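(* Let $d\ge 1$, let $\Gamma\subset\mathbb{Z}^{d}$ be a finite non-empty set of size $|\Gamma|=D$, and let $x_1,\ldots,x_n$ be i.i.d. random variables that are uniformly distributed on $[0,1]^d$. Let $U$ be the random $n\times D$ matrix with entries $u_{tk}=e^{2\pi i k\cdot x_t}$, $t=1,\ldots,n$, $k\in\Gamma$. Choose $0<\varepsilon<1$, $0<\alpha<\varepsilon^{2}$, and $\delta>0$. If $$\left\lfloor\frac{\alpha n}{3D}\right\rfloor\ge\left[\ln\left(\frac{\varepsilon^{2}}{\alpha}\right)\right]^{-1}\ln\left(\frac{D}{\delta(1-\alpha)}\right),$$ then, with probability at least $1-\delta$, we have $$\left\Vert n^{-1}U^{*}U-I\right\Vert<\varepsilon$$ and hence $$1-\varepsilon<\lambda_{\min}(n^{-1}U^{*}U)\le\lambda_{\max}(n^{-1}U^{*}U)<1+\varepsilon.$$ Consequently, the condition number of $U^{*}U$ is bounded by $\frac{1+\varepsilon}{1-\varepsilon}$ with probability at least $1-\delta$.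
   Context: For a matrix $A$, $A^{*}$ is its conjugate transpose, $\Vert A\Vert=\lambda_{\max}(A^{*}A)^{1/2}$ is the operator norm, and for hermitian $A$, $\lambda_{\max}(A)$, $\lambda_{\min}(A)$ are the largest and smallest eigenvalues; the condition number of $A$ is $\lambda_{\max}(A)/\lambda_{\min}(A)$. $I$ is the $D\times D$ identity matrix, and $k\cdot x$ is the standard inner product on $\mathbb{R}^d$. *)

(* Defs.v *)
From HB Require Import structures.
From mathcomp Require Import all_boot all_order all_algebra finmap.
From mathcomp Require Import complex.
From mathcomp Require Import all_classical all_reals all_analysis.

Set Implicit Arguments.
Unset Strict Implicit.
Unset Printing Implicit Defensive.

Import Order.TTheory GRing.Theory Num.Theory.
Import numFieldNormedType.Exports.

Local Open Scope classical_set_scope.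
Local Open Scope ring_scope.
Local Open Scope complex_scope.

Section hermitian_spectrum.
Context {R : realType}.

(* [eigenvalue] is about left eigenvectors, which gives the usual spectrum of a
   square matrix. For a hermitian matrix of positive size the set below is
   finite, nonempty and is the whole spectrum, so that its supremum and infimum
   are the largest and the smallest eigenvalue. *)
Definition real_spectrum (m : nat) (A : 'M[R[i]]_m) : set R :=
  [set r : R | eigenvalue A r%:C].

Definition lambda_max (m : nat) (A : 'M[R[i]]_m) : R := sup (real_spectrum A).

Definition lambda_min (m : nat) (A : 'M[R[i]]_m) : R := inf (real_spectrum A).

Definition opnorm (m p : nat) (A : 'M[R[i]]_(m, p)) : R :=
  Num.sqrt (lambda_max (A^t*%sesqui *m A)).

(* Extended-real division, in which [x / 0 = +oo] for [0 < x]: a nonzero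
   singular positive semidefinite matrix has condition number [+oo], and not
   [0] as with the division of [R]. *)
Definition cond_number (m : nat) (A : 'M[R[i]]_m) : \bar R :=
  ((lambda_max A)%:E / (lambda_min A)%:E)%E.

End hermitian_spectrum.

Section fourier_matrix.
Context {R : realType}.

Definition cexp (z : R[i]) : R[i] :=
  (expR (complex.Re z))%:C * (cos (complex.Im z) +i* sin (complex.Im z)).

Definition dotZR (d : nat) (k : 'rV[int]_d) (x : d.-tuple R) : R :=
  \sum_(j < d) (k 0 j)%:~R * tnth x j.

(* The columns are indexed by [Gamma] through its canonical enumeration. This is
   to be used with [#|` Gamma| = D]; the default value of the sequence access
   is then never reached. *)
Definition fourier_mx (d n D : nat) (Gamma : {fset 'rV[int]_d})
    (x : 'I_n -> d.-tuple R) : 'M[R[i]]_(n, D) :=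
  \matrix_(t < n, j < D)
    cexp (2 * pi%:C * 'i * (dotZR (enum_fset Gamma)`_j (x t))%:C).

End fourier_matrix.

Section probability_notions.
Context {dT : measure_display} {T : measurableType dT} {R : realType}.

Definition mutually_independent (dS : measure_display) (S : measurableType dS)
    (P : probability T R) (I : finType) (X : I -> {RV P >-> S}) : Prop :=
  forall (J : {set I}) (A : I -> set S),
    (forall t, t \in J -> measurable (A t)) ->
    P (\bigcap_(t in [set` J]) (X t @^-1` A t)) =
    (\big[*%E/1%E]_(t in J) P (X t @^-1` A t))%E.

(* The law of [X] is the [d]-fold product of the uniform law on [[0, 1]], i.e.
   the probability determined by its values on measurable rectangles. *)
Definition uniform_on_cube (d : nat) (P : probability T R)
    (X : {RV P >-> d.-tuple R}) : Prop :=
  forall A : 'I_d -> set R, (forall j, measurable (A j)) ->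
    distribution P X [set v | forall j, A j (tnth v j)] =
    (\big[*%E/1%E]_(j < d) uniform_prob (@ltr01 R) (A j))%E.

Definition holds_with_prob_ge (P : probability T R) (p : R) (E : set T) : Prop :=
  measurable E /\ (p%:E <= P E)%E.

End probability_notions.

(* Main.v *)
(* Let X = n^-1 U^*U - I and m = floor (alpha n / (3D)). By Markov's inequality
   P (||X|| >= eps) <= eps^(-2m) E tr X^(2m). Expanding the trace over closed walks
   k_0, ..., k_p = k_0 in Gamma without stationary step and over words t in [n]^p,
   p = 2m, the expectation of each term is 1 when, for every letter s of t, the
   increments k_{l+1} - k_l with t_l = s sum to zero, and is 0 otherwise. Such walks
   exist only if every letter of t occurs at least twice, and there are at most
   D^(p+1-b) of them if t has b letters, since a walk is determined by its last
   vertex and its vertices away from first occurrences of letters. It remains to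
   estimate a_p, the sum of D^(-b) over the words of length p without singletons.
   Deleting a letter gives a_{p+2} <= (p+1)/2 a_{p+1} + (p+1) (n/D) a_p, whence
   a_{2m} <= (alpha (n/D)^2)^m and E tr X^(2m) <= D alpha^m. *)

Require Import Defs.
From HB Require Import structures.
From mathcomp Require Import all_boot all_order all_algebra finmap.
From mathcomp Require Import complex.
From mathcomp Require Import all_classical all_reals all_analysis.
From mathcomp Require Import measurable_realfun ring lra.

Set Implicit Arguments.
Unset Strict Implicit.
Unset Printing Implicit Defensive.

Import Order.TTheory GRing.Theory Num.Theory.
Import numFieldNormedType.Exports.

Local Open Scope classical_set_scope.
Local Open Scope ring_scope.

(** * Words without singletons *)

(** Two obstacles shape the proof. Independence is given for events and the uniform law for
    rectangles, whereas the walk terms need means of characters; indicators are therefore replaced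
    by sines and cosines, one scalar coordinate at a time, by uniform approximation with simple
    functions. Moreover, each probability bound includes the measurability of an event about a
    supremum or infimum of eigenvalues; this is recovered from traces of powers, which are
    polynomial in the entries. The coefficients of the recurrence for a_p grow with p, so a
    geometric bound a_p <= c^p can only be carried up to some exponent. The choice c = sqrt(alpha)
    n/D makes it valid up to p = 2m, and this is what limits m. *)

Section words_without_singletons.

(** A word is the same as its letter at position [i] together with the word left after deleting that
    position. This drives the induction on words and, later, the unfolding of matrix powers. *)
Lemma sum_ffun_lift (T : finType) (V : nmodType) (n : nat) (i : 'I_n.+1)
    (F : T -> {ffun 'I_n -> T} -> V) :
  \sum_(f : {ffun 'I_n.+1 -> T}) F (f i) [ffun j => f (lift i j)] =
  \sum_s \sum_g F s g.
Proof.
rewrite pair_big /=.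
rewrite (reindex (fun q : T * {ffun 'I_n -> T} =>
  [ffun j => if unlift i j is Some j' then q.2 j' else q.1])) /=.
  apply: eq_bigr => -[s g] _ /=; rewrite ffunE unlift_none; congr F.
  by apply/ffunP => j; rewrite !ffunE liftK.
exists (fun f => (f i, [ffun j => f (lift i j)])) => [[s g]|f] _ /=.
  rewrite ffunE unlift_none; congr pair.
  by apply/ffunP => j; rewrite !ffunE liftK.
by apply/ffunP => j; rewrite !ffunE; case: unliftP => [j'|] ->; rewrite ?ffunE.
Qed.

Definition no_singleton (T : finType) (p : nat) (t : {ffun 'I_p -> T}) :=
  [forall j, [exists j', (j' != j) && (t j' == t j)]].

Definition word_letters (T : finType) (p : nat) (t : {ffun 'I_p -> T}) : {set T} :=
  [set t j | j in 'I_p].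

(** With [z] the inverse of the number of vertices, this is the share of all vertex sequences that
    the bound on walks allows for the word [t]. *)
Definition word_weight (K : numFieldType) (T : finType) (z : K) (p : nat)
    (t : {ffun 'I_p -> T}) : K :=
  if no_singleton t then z ^+ #|word_letters t| else 0.

Variables (K : realFieldType) (T : finType) (z : K).
Hypothesis z0 : 0 <= z.

Lemma word_weight_ge0 p (t : {ffun 'I_p -> T}) : 0 <= word_weight z t.
Proof. by rewrite /word_weight; case: ifP => // _; rewrite exprn_ge0. Qed.

(** The fibres of [t] partition the positions, and each has at least two elements. This is the
    origin of the factor 1/2 in the recurrence. *)
Lemma card_word_letters_le p (t : {ffun 'I_p -> T}) : no_singleton t ->
  (#|word_letters t|.*2 <= p)%N.
Proof.
move=> /forallP nt; have sum1 : (\sum_(j < p) 1 = p)%N by rewrite sum1_card card_ord.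
rewrite -[leqRHS]sum1 {sum1}.
rewrite (partition_big t (mem (word_letters t))) /=; last by move=> j _; exact: imset_f.
rewrite -muln2 -sum_nat_const; apply: leq_sum => s /imsetP [j _ ->].
have /existsP [j' /andP [jj' /eqP tj']] := nt j.
by rewrite (bigD1 j) //= (bigD1 j') /= ?tj' ?eqxx.
Qed.

(* Delete the first letter: either it still occurs in a word without singletons,
   or exactly one other copy of it is left, which is deleted as well. *)
Lemma word_weight_rec p (f : {ffun 'I_p.+2 -> T}) (g : {ffun 'I_p.+1 -> T}) :
  g = [ffun j => f (lift ord0 j)] ->
  word_weight z f <= (f ord0 \in word_letters g)%:R * word_weight z g +
    \sum_(i < p.+1) (g i == f ord0)%:R * (z * word_weight z [ffun j => g (lift i j)]).
Proof.
move=> gE0.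
have sum0 : 0 <= \sum_(i < p.+1) (g i == f ord0)%:R *
    (z * word_weight z [ffun j => g (lift i j)]).
  by apply: sumr_ge0 => i _; rewrite !mulr_ge0 ?word_weight_ge0.
have [nf|nf] := boolP (no_singleton f); last first.
  by rewrite {1}/word_weight (negbTE nf) addr_ge0 // mulr_ge0 // word_weight_ge0.
rewrite {1}/word_weight nf; move/forallP: nf => nf.
have gE j : g j = f (lift ord0 j) by rewrite gE0 ffunE.
have [ng|/forallPn[j nj]] := boolP (no_singleton g).
  have /existsP [j /andP [j0 /eqP fj]] := nf ord0.
  have f0 : f ord0 \in word_letters g.
    apply/imsetP; case: (unliftP ord0 j) j0 fj => [j' ->|->]; last by rewrite eqxx.
    by move=> _ <-; exists j' => //; rewrite gE.
  rewrite f0 mul1r /word_weight ng ler_wpDr //.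
  rewrite (_ : word_letters f = word_letters g) //.
  apply/setP => s; apply/imsetP/imsetP => -[k _ ->].
    case: (unliftP ord0 k) => [k' ->|->]; last by move/imsetP: f0 => [k' _ ->]; exists k'.
    by exists k' => //; rewrite gE.
  by exists (lift ord0 k) => //; rewrite gE.
have only_j j' : g j' = g j -> j' = j.
  move=> gj; apply/eqP/negPn/negP => jj; move/existsPn: nj => /(_ j').
  by rewrite jj gj eqxx.
(* The letter at [j] is single in [g] but not in [f], so its other copy is the deleted one. *)
have gj : g j = f ord0.
  have /existsP [k /andP [kj /eqP fk]] := nf (lift ord0 j).
  case: (unliftP ord0 k) kj fk => [k' ->|-> _ ->]; last by rewrite gE.
  by move=> kj; rewrite -!gE => /only_j kj'; rewrite kj' eqxx in kj.
set h := [ffun k => g (lift j k)].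
have hE k : h k = f (lift ord0 (lift j k)) by rewrite ffunE gE.
have f0h : f ord0 \notin word_letters h.
  apply/imsetP => -[k _]; rewrite ffunE -gj => /esym /only_j /eqP.
  by rewrite eq_sym (negbTE (neq_lift _ _)).
have nh : no_singleton h.
  apply/forallP => k; have /existsP [l /andP [lk /eqP fl]] := nf (lift ord0 (lift j k)).
  rewrite -hE in fl; case: (unliftP ord0 l) lk fl => [l' ->|->]; last first.
    by move=> _ f0; case/negP: f0h; rewrite f0; apply: imset_f.
  case: (unliftP j l') => [l'' ->|->]; last first.
    by move=> _; rewrite -gE gj => f0; case/negP: f0h; rewrite f0; apply: imset_f.
  move=> lk; rewrite -hE => fl; apply/existsP; exists l''; rewrite fl eqxx andbT.
  by apply: contra_neq lk => ->.
apply: le_trans (_ : \sum_(i < p.+1) (g i == f ord0)%:R *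
    (z * word_weight z [ffun j => g (lift i j)]) <= _); last first.
  by rewrite lerDr mulr_ge0 // word_weight_ge0.
rewrite (bigD1 j) //= -/h gj eqxx mul1r {1}/word_weight nh.
rewrite (_ : word_letters f = f ord0 |: word_letters h).
  rewrite cardsU1 f0h add1n exprS lerDl.
  by apply: sumr_ge0 => i _; rewrite !mulr_ge0 ?word_weight_ge0.
apply/setP => s; rewrite !inE; apply/imsetP/orP.
  move=> [k _ ->]; case: (unliftP ord0 k) => [k' ->|->]; last by left.
  case: (unliftP j k') => [k'' ->|->]; last by left; rewrite -gE gj.
  by right; rewrite -hE imset_f.
move=> [/eqP ->|/imsetP [k _ ->]]; first by exists ord0.
by exists (lift ord0 (lift j k)).
Qed.

Definition total_weight p : K := \sum_(t : {ffun 'I_p -> T}) word_weight z t.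

(** Group the words by what is left after deleting the first letter. In the first case the deleted
    letter is one of the at most (p+1)/2 letters of [g]; in the second its other copy sits at one of
    p+1 positions and may be any of the [#|T|] letters. *)
Lemma total_weight_rec p :
  total_weight p.+2 <= (p.+1)%:R / 2 * total_weight p.+1 +
                       (p.+1)%:R * (z * #|T|%:R) * total_weight p.
Proof.
pose G s (g : {ffun 'I_p.+1 -> T}) := (s \in word_letters g)%:R * word_weight z g +
    \sum_(i < p.+1) (g i == s)%:R * (z * word_weight z [ffun j => g (lift i j)]).
apply: le_trans (_ : \sum_(f : {ffun 'I_p.+2 -> T})
    G (f ord0) [ffun j => f (lift ord0 j)] <= _).
  by apply: ler_sum => f _; exact: word_weight_rec.
rewrite sum_ffun_lift /G.
rewrite exchange_big /=.
under eq_bigr do rewrite big_split /=.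
rewrite big_split /= lerD //.
  rewrite /total_weight mulr_sumr; apply: ler_sum => g _.
  rewrite -mulr_suml; have [ng|ng] := boolP (no_singleton g); last first.
    by rewrite /word_weight (negbTE ng) !mulr0.
  rewrite ler_wpM2r ?word_weight_ge0 //.
  rewrite -natr_sum (_ : (\sum_s (s \in word_letters g) = #|word_letters g|)%N); last first.
    by rewrite -sum1_card [RHS]big_mkcond; apply: eq_bigr => s _; case: (s \in _).
  rewrite ler_pdivlMr // -natrM ler_nat muln2.
  exact: card_word_letters_le.
under eq_bigr do rewrite exchange_big /=.
rewrite exchange_big /=.
have Ei (i : 'I_p.+1) : \sum_(g : {ffun 'I_p.+1 -> T}) \sum_s (g i == s)%:R *
    (z * word_weight z [ffun j => g (lift i j)]) = z * #|T|%:R * total_weight p.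
  pose F (s : T) (h : {ffun 'I_p -> T}) := z * word_weight z h.
  transitivity (\sum_(g : {ffun 'I_p.+1 -> T}) F (g i) [ffun j => g (lift i j)]).
    apply: eq_bigr => g _; rewrite (bigD1 (g i)) //= eqxx mul1r big1 ?addr0 //.
    by move=> s sg; rewrite eq_sym (negbTE sg) mul0r.
  rewrite (sum_ffun_lift i F) /F sumr_const -mulr_sumr -/(total_weight p).
  rewrite -[LHS]mulr_natr; ring.
rewrite (eq_bigr _ (fun i _ => Ei i)) sumr_const card_ord.
by rewrite -[leLHS]mulr_natl mulrA.
Qed.

Lemma total_weight0 : total_weight 0 = 1.
Proof.
have t0 (t : {ffun 'I_0 -> T}) : word_weight z t = 1.
  rewrite /word_weight ifT; last by apply/forallP => -[].
  rewrite (_ : #|word_letters t| = 0%N) //.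
  by apply: eq_card0 => s; apply/imsetP => -[[]].
rewrite /total_weight (eq_bigr _ (fun t _ => t0 t)) sumr_const card_ffun card_ord expn0.
by [].
Qed.

Lemma total_weight1 : total_weight 1 = 0.
Proof.
rewrite /total_weight big1 // => t _; rewrite /word_weight ifF //.
apply/negbTE/forallPn; exists ord0; apply/existsPn => j.
by rewrite (ord1 j) eqxx.
Qed.

(** The condition says that the powers of [c] dominate the recurrence. As its left side grows with
    [p], it is only asked below [q]. *)
Lemma total_weight_le (c : K) (q : nat) : 0 <= c ->
  (forall p, (p < q)%N -> p%:R / 2 * c + p%:R * (z * #|T|%:R) <= c ^+ 2) ->
  forall p, (p <= q)%N -> total_weight p <= c ^+ p.
Proof.
move=> c0 cq p; have [k] := ubnP p; elim: k p => // k IH [|[|p]] pk pq.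
- by rewrite total_weight0 expr0.
- by rewrite total_weight1 exprn_ge0.
apply: le_trans (total_weight_rec p) _.
apply: le_trans (_ : (p.+1%:R / 2 * c + p.+1%:R * (z * #|T|%:R)) * c ^+ p <= _); last first.
  rewrite (_ : c ^+ p.+2 = c ^+ 2 * c ^+ p); last by rewrite -exprD.
  by rewrite ler_wpM2r ?exprn_ge0 // cq.
have I1 : total_weight p.+1 <= c ^+ p.+1 by apply: IH => //; exact: ltnW.
have I0 : total_weight p <= c ^+ p.
  by apply: IH; [exact: ltnW|exact: ltnW (ltnW pq)].
rewrite mulrDl lerD //; first by rewrite -[leRHS]mulrA -exprS ler_wpM2l ?divr_ge0.
by rewrite ler_wpM2l // !mulr_ge0.
Qed.

End words_without_singletons.

(** * Independent uniform variables and characters *)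

Section bounded_random_variables.
Context {dT : measure_display} {T : measurableType dT} {R : realType}.
Variable P : probability T R.

(** A class closed under sums and products, all of whose members are integrable for a probability,
    so that [mean] is linear on every trigonometric polynomial below. *)
Definition bounded_measurable (f : T -> R) :=
  measurable_fun setT f /\ exists M, forall w, `|f w| <= M.

Lemma bounded_measurable_integrable f : bounded_measurable f ->
  P.-integrable setT (EFin \o f).
Proof.
move=> [mf [M fM]]; apply: measurable_bounded_integrable => //.
  exact: le_lt_trans (probability_le1 P measurableT) (ltry _).
exists M; split; first exact: num_real.
by move=> x Mx w _; apply: le_trans (fM w) (ltW Mx).
Qed.

Lemma bounded_measurable_cst c : bounded_measurable (fun=> c).
Proof. by split; [exact: measurable_cst|exists `|c|]. Qed.

Lemma bounded_measurableD f g : bounded_measurable f -> bounded_measurable g ->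
  bounded_measurable (fun w => f w + g w).
Proof.
move=> [mf [M fM]] [mg [N gN]]; split; first exact: measurable_funD.
by exists (M + N) => w; apply: le_trans (ler_normD _ _) (lerD (fM w) (gN w)).
Qed.

Lemma bounded_measurableM f g : bounded_measurable f -> bounded_measurable g ->
  bounded_measurable (fun w => f w * g w).
Proof.
move=> [mf [M fM]] [mg [N gN]]; split; first exact: measurable_funM.
by exists (M * N) => w; rewrite normrM ler_pM.
Qed.

Lemma bounded_measurable_sum (I : Type) (r : seq I) (Q : pred I) (f : I -> T -> R) :
  (forall i, bounded_measurable (f i)) ->
  bounded_measurable (fun w => \sum_(i <- r | Q i) f i w).
Proof.
move=> bf; elim: r => [|i r IH].
  under eq_fun do rewrite big_nil; exact: bounded_measurable_cst.
under eq_fun do rewrite big_cons.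
by case: (Q i) => //; exact: bounded_measurableD.
Qed.

Lemma bounded_measurable_prod (I : Type) (r : seq I) (Q : pred I) (f : I -> T -> R) :
  (forall i, bounded_measurable (f i)) ->
  bounded_measurable (fun w => \prod_(i <- r | Q i) f i w).
Proof.
move=> bf; elim: r => [|i r IH].
  under eq_fun do rewrite big_nil; exact: bounded_measurable_cst.
under eq_fun do rewrite big_cons.
by case: (Q i) => //; exact: bounded_measurableM.
Qed.

Lemma bounded_measurable_indic (A : set T) : measurable A ->
  bounded_measurable (fun w => \1_A w).
Proof.
move=> mA; split; first exact: measurable_indic.
by exists 1 => w; rewrite indicE; case: (_ \in _); rewrite ?normr1 ?normr0.
Qed.

Lemma bounded_measurable_cos f : measurable_fun setT f ->
  bounded_measurable (fun w => cos (f w)).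
Proof.
move=> mf; split; last by exists 1 => w; rewrite ler_norml cos_geN1 cos_le1.
by apply: (measurableT_comp (continuous_measurable_fun _) mf); exact: continuous_cos.
Qed.

Lemma bounded_measurable_sin f : measurable_fun setT f ->
  bounded_measurable (fun w => sin (f w)).
Proof.
move=> mf; split; last by exists 1 => w; rewrite ler_norml sin_geN1 sin_le1.
by apply: (measurableT_comp (continuous_measurable_fun _) mf); exact: continuous_sin.
Qed.

Definition mean (f : T -> R) : R := \int[P]_w f w.

Lemma mean_cst c : mean (fun=> c) = c.
Proof.
have P1 : fine (P setT) = 1 by rewrite probability_setT.
by rewrite /mean Rintegral_cst // -[RHS]mulr1; congr (_ * _); exact: P1.
Qed.

Lemma meanD f g : bounded_measurable f -> bounded_measurable g ->
  mean (fun w => f w + g w) = mean f + mean g.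
Proof. by move=> bf bg; rewrite /mean RintegralD//; exact: bounded_measurable_integrable. Qed.

Lemma meanZ c f : bounded_measurable f -> mean (fun w => c * f w) = c * mean f.
Proof. by move=> bf; rewrite /mean RintegralZl//; exact: bounded_measurable_integrable. Qed.

Lemma meanB f g : bounded_measurable f -> bounded_measurable g ->
  mean (fun w => f w - g w) = mean f - mean g.
Proof. by move=> bf bg; rewrite /mean RintegralB//; exact: bounded_measurable_integrable. Qed.

Lemma mean_sum (I : Type) (r : seq I) (Q : pred I) (f : I -> T -> R) :
  (forall i, bounded_measurable (f i)) ->
  mean (fun w => \sum_(i <- r | Q i) f i w) = \sum_(i <- r | Q i) mean (f i).
Proof.
move=> bf; elim: r => [|i r IH].
  by under eq_fun do rewrite big_nil; rewrite mean_cst big_nil.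
under eq_fun do rewrite big_cons; rewrite big_cons.
case: (Q i) => //; rewrite meanD ?IH //; exact: bounded_measurable_sum.
Qed.

Lemma mean_le f g : bounded_measurable f -> bounded_measurable g ->
  (forall w, f w <= g w) -> mean f <= mean g.
Proof.
move=> bf bg fg.
by apply: le_Rintegral => //; exact: bounded_measurable_integrable.
Qed.

Lemma mean_indic (A : set T) : measurable A -> mean (fun w => \1_A w) = fine (P A).
Proof. by move=> mA; rewrite /mean /Rintegral integral_indic // setIT. Qed.

Lemma mean_norm_le f e : bounded_measurable f -> (forall w, `|f w| <= e) ->
  `|mean f| <= e.
Proof.
move=> bf fe; have bc := bounded_measurable_cst.
rewrite ler_norml -{2}(mean_cst e) -(mean_cst (- e)).
apply/andP; split; apply: mean_le => // w; have := fe w; rewrite ler_norml => /andP [] //.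
Qed.

End bounded_random_variables.

(** Cut the range [-M, M] into slices of width [e], and replace [f] by the lower end of the slice in
    which its value lies. *)
Lemma simple_uniform_approx (R : realType) (f : R -> R) (M e : R) :
  measurable_fun setT f -> (forall x, `|f x| <= M) -> 0 < e ->
  exists (L : nat) (c : 'I_L -> R) (A : 'I_L -> set R),
    (forall j, measurable (A j)) /\
    forall x, `|f x - \sum_(j < L) c j * \1_(A j) x| <= e.
Proof.
move=> mf fM e0.
pose L := (Num.truncn (2 * M / e)).+1.
pose c (j : 'I_L) : R := j%:R * e - M.
pose A (j : 'I_L) : set R := f @^-1` `[c j, c j + e[.
exists L, c, A; split=> [j|x].
  by rewrite -[X in measurable X]setTI; apply: mf.
have M0 : 0 <= M by apply: le_trans (fM 0).
have := fM x; rewrite ler_norml => /andP [fM1 fM2].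
have y0 : 0 <= (f x + M) / e by rewrite divr_ge0 ?(ltW e0) //; lra.
have [k kL [k1 k2]] : exists2 k, (k < L)%N &
    k%:R * e <= f x + M /\ f x + M < k%:R * e + e.
  have /andP [] := truncn_itv y0; set k := Num.truncn _ => k1 k2; exists k.
    by rewrite ltnS; apply: le_truncn; rewrite ler_pM2r ?invr_gt0 //; lra.
  by move: k1 k2; rewrite ler_pdivlMr // ltr_pdivrMr // -natr1 mulrDl mul1r.
rewrite (bigD1 (Ordinal kL)) //= big1 ?addr0.
  rewrite indicE mem_set; last by rewrite /A /= in_itv /= /c /=; apply/andP; split; lra.
  by rewrite mulr1 ler_norml /c /=; apply/andP; split; lra.
move=> j jk; rewrite indicE memNset ?mulr0 //.
rewrite /A /= in_itv /= /c => /andP [h1 h2].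
case/eqP: jk; apply: val_inj => /=; apply/eqP.
(* Both slices contain [f x], so their lower ends are less than [e] apart and their indices
   agree. *)
have le_of_scaled (a b : nat) : a%:R * e < b%:R * e + e -> (a <= b)%N.
  by rewrite -{3}[e]mul1r -mulrDl natr1 ltr_pM2r // ltr_nat ltnS.
by rewrite eqn_leq; apply/andP; split; apply: le_of_scaled; lra.
Qed.

Section replace_indicator.
Context {dT : measure_display} {T : measurableType dT} {R : realType}.
Variable P : probability T R.

(** Both sides are linear in [f] and continuous for uniform convergence, so the identity passes from
    indicators to simple functions and then to their uniform limits. *)
Lemma mean_replace_indic (Z g : T -> R) (C : R) (f : R -> R) :
  measurable_fun setT Z -> bounded_measurable g ->
  (forall A, measurable A ->
    mean P (fun w => \1_A (Z w) * g w) = C * mean P (fun w => \1_A (Z w))) ->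
  measurable_fun setT f -> (exists M, forall x, `|f x| <= M) ->
  mean P (fun w => f (Z w) * g w) = C * mean P (fun w => f (Z w)).
Proof.
move=> mZ bg indicC mf [M fM].
have bfZ : bounded_measurable (fun w => f (Z w)).
  by split; [exact: measurableT_comp|exists M].
have [_ [G gG]] := bg.
have G0 : 0 <= G by apply: le_trans (gG point).
apply/eqP; rewrite -subr_eq0 -normr_le0; apply/ler_addgt0Pl => e e0; rewrite addr0.
(* The two errors are at most [G] and [|C|] times this tolerance, hence at most [e] together; the
   added 1 keeps the denominator positive. *)
have d0 : 0 < e / (G + `|C| + 1) by rewrite divr_gt0 // ltr_wpDl // addr_ge0.
have [L [c [A [mA fA]]]] := simple_uniform_approx mf fM d0.
pose h x := \sum_(j < L) c j * \1_(A j) x.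
have bind j : bounded_measurable (fun w => \1_(A j) (Z w)).
  by apply: (bounded_measurable_indic (A := Z @^-1` A j));
    rewrite -[X in measurable X]setTI; exact: mZ.
have bch j : bounded_measurable (fun w => c j * \1_(A j) (Z w)).
  by apply: bounded_measurableM => //; exact: bounded_measurable_cst.
have bhZ : bounded_measurable (fun w => h (Z w)) by exact: bounded_measurable_sum.
have hC : mean P (fun w => h (Z w) * g w) = C * mean P (fun w => h (Z w)).
  rewrite /h mean_sum // mulr_sumr.
  under eq_fun do rewrite mulr_suml.
  rewrite mean_sum; last by move=> j; exact: bounded_measurableM.
  apply: eq_bigr => j _; rewrite meanZ // mulrCA -indicC // -meanZ.
    by congr mean; apply/funext => w; rewrite mulrA.
  exact: bounded_measurableM.
have bfg := bounded_measurableM bfZ bg; have bhg := bounded_measurableM bhZ bg.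
have -> : mean P (fun w => f (Z w) * g w) - C * mean P (fun w => f (Z w)) =
    mean P (fun w => (f (Z w) - h (Z w)) * g w) -
    C * mean P (fun w => f (Z w) - h (Z w)).
  rewrite [mean P (fun w => f (Z w) - _)]meanB //.
  under [X in _ = mean P X - _]eq_fun do rewrite mulrBl.
  by rewrite meanB // hC; ring.
have bfh : bounded_measurable (fun w => f (Z w) - h (Z w)).
  have -> : (fun w => f (Z w) - h (Z w)) = (fun w => f (Z w) + (-1) * h (Z w)).
    by apply/funext => w; rewrite mulN1r.
  apply: bounded_measurableD => //; apply: bounded_measurableM => //.
  exact: bounded_measurable_cst.
have E1 : `|mean P (fun w => (f (Z w) - h (Z w)) * g w)| <= e / (G + `|C| + 1) * G.
  apply: mean_norm_le => [|w]; first exact: bounded_measurableM.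
  by rewrite normrM ler_pM // fA.
have E2 : `|mean P (fun w => f (Z w) - h (Z w))| <= e / (G + `|C| + 1).
  by apply: mean_norm_le => // w; exact: fA.
apply: le_trans (ler_normB _ _) _; rewrite normrM.
apply: le_trans (lerD E1 (ler_wpM2l (normr_ge0 C) E2)) _.
have n0 : 0 <= `|C| by [].
rewrite (mulrC `|C|) -mulrDr mulrAC ler_pdivrMr; last by lra.
by rewrite ler_wpM2l ?(ltW e0) // lerDl.
Qed.

End replace_indicator.

(** * Fourier coefficients of the uniform law *)

Section uniform_fourier.
Context {R : realType}.

Lemma sin_int_period (x : R) (m : int) : sin (x + 2 * pi * m%:~R) = sin x.
Proof.
have E (k : nat) y : sin (y + 2 * pi * k%:R) = sin y :> R.
  have -> : 2 * pi * k%:R = (pi *+ 2) *+ k :> R.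
    by rewrite -[RHS]mulr_natr -[pi *+ 2]mulr_natl.
  by rewrite (periodicn (@sinD2pi R)).
case: m => k; first by rewrite -pmulrn E.
by rewrite NegzE mulrNz -pmulrn -[LHS](E k.+1) mulrN; congr sin; ring.
Qed.

Lemma continuous_sin_affine (a b : R) : continuous (fun x : R => sin (a * x + b)).
Proof.
move=> x; apply: (@continuous_comp _ _ _ (fun x : R => a * x + b) sin);
  last exact: continuous_sin.
apply: cvgD; last exact: cvg_cst.
by apply: cvgM; [exact: cvg_cst|exact: cvg_id].
Qed.

(** The sine integrates to 0 over a whole number of periods. The added 1 makes the integrand
    nonnegative, so that integration against a law applies to it without integrability
    conditions. *)
Lemma integral_uniform_1Dsin (m : int) (b : R) : m != 0 ->
  (\int[uniform_prob (@ltr01 R)]_x (1 + sin (2 * pi * m%:~R * x + b))%:E = 1)%E.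
Proof.
move=> m0; set a := 2 * pi * m%:~R.
have a0 : a != 0 by rewrite !mulf_neq0 ?intr_eq0 // lt0r_neq0 // pi_gt0.
have cf : continuous (fun x : R => 1 + sin (a * x + b)).
  by move=> x; apply: cvgD; [exact: cvg_cst|exact: continuous_sin_affine].
rewrite integral_uniform; last 2 first.
- by apply/measurable_EFinP; exact: continuous_measurable_fun.
- move=> x; rewrite lee_fin; have := sin_geN1 (a * x + b); lra.
rewrite subr0 invr1 mul1e.
pose F (x : R) := x - a^-1 * cos (a * x + b).
have dF (x : R) : is_derive x 1 F (1 + sin (a * x + b)).
  rewrite /F; apply: is_derive_eq.
  by rewrite addr0 /GRing.scale /= mulr1; field.
have cF : continuous F.
  by move=> x; apply/differentiable_continuous/derivable1_diffP; have [] := dF x.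
rewrite (continuous_FTC2 ltr01 (F := F)).
- rewrite -EFinB /F mulr0 !add0r mulr1 (addrC a).
  have -> : cos (b + a) = cos b.
    have cosS y : cos y = sin (y + pi / 2) :> R.
      by rewrite sinD cos_pihalf sin_pihalf mulr0 add0r mulr1.
    by rewrite !cosS addrAC sin_int_period.
  by congr EFin; ring.
- by apply: continuous_subspaceT.
- split; first by move=> x _; have [] := dF x.
    by apply: cvg_at_right_filter; exact: cF.
  by apply: cvg_at_left_filter; exact: cF.
- by move=> x _; rewrite derive1E; have [] := dF x.
Qed.
End uniform_fourier.

Section mean_of_characters.
Context {dT : measure_display} {T : measurableType dT} {R : realType}.
Variable P : probability T R.

Definition law_on_unit_interval (Z : {RV P >-> R}) :=
  forall A, measurable A -> P (Z @^-1` A) = uniform_prob (@ltr01 R) A.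

(** The shift [b] treats the sine (b = 0) and the cosine (b = pi/2) together. *)
Lemma mean_sin_affine (Z : {RV P >-> R}) (m : int) (b : R) :
  law_on_unit_interval Z -> m != 0 ->
  mean P (fun w => sin (2 * pi * m%:~R * Z w + b)) = 0.
Proof.
move=> lawZ m0.
have mh : measurable_fun setT (fun x : R => sin (2 * pi * m%:~R * x + b)).
  by apply: continuous_measurable_fun; exact: continuous_sin_affine.
have bs : bounded_measurable (fun w => sin (2 * pi * m%:~R * Z w + b)).
  apply: bounded_measurable_sin; apply: measurable_funD; last exact: measurable_cst.
  by apply: measurable_funM => //; exact: measurable_cst.
have : mean P (fun w => 1 + sin (2 * pi * m%:~R * Z w + b)) = 1.
  rewrite /mean /Rintegral.
  have -> : (\int[P]_w (1 + sin (2 * pi * m%:~R * Z w + b))%:E = 1)%E => //.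
  rewrite -(integral_uniform_1Dsin b m0).
  (* [uniform_prob] lives on the display generated by intervals, not on the default one. *)
  have mZ : measurable_fun setT (Z : T -> measurableTypeR R).
    by move=> _ A mA; exact: (measurable_funPT Z).
  pose Z' : {mfun T >-> measurableTypeR R} :=
    HB.pack (Z : T -> measurableTypeR R) (isMeasurableFun.Build _ _ _ _ _ mZ).
  transitivity (\int[distribution P Z']_x (1 + sin (2 * pi * m%:~R * x + b))%:E)%E;
    last by apply: (eq_measure_integral (uniform_prob (@ltr01 R))) => A mA _; exact: lawZ.
  rewrite ge0_integral_distribution //.
    apply/measurable_EFinP; apply: measurable_funD; first exact: measurable_cst.
    by move=> _ A mA; exact: mh.
rewrite (meanD P (bounded_measurable_cst 1) bs) mean_cst; lra.
Qed.

Lemma measurable_character (m : int) :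
  measurable_fun setT (fun x : R => cos (2 * pi * m%:~R * x)) /\
  measurable_fun setT (fun x : R => sin (2 * pi * m%:~R * x)).
Proof.
have ma : measurable_fun setT (fun x : R => 2 * pi * m%:~R * x).
  by apply: measurable_funM => //; exact: measurable_cst.
split; apply: (measurableT_comp (continuous_measurable_fun _) ma).
  exact: continuous_cos.
exact: continuous_sin.
Qed.

Lemma mean_character (Z : {RV P >-> R}) (m : int) : law_on_unit_interval Z ->
  mean P (fun w => cos (2 * pi * m%:~R * Z w)) = (m == 0)%:R /\
  mean P (fun w => sin (2 * pi * m%:~R * Z w)) = 0.
Proof.
move=> lawZ; have [->|m0] := eqVneq m 0.
  under eq_fun do rewrite mulr0 mul0r cos0.
  by under [in X in _ /\ X]eq_fun do rewrite mulr0 mul0r sin0; rewrite !mean_cst.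
split; last by rewrite -(mean_sin_affine 0 lawZ m0); under [in RHS]eq_fun do rewrite addr0.
rewrite -[RHS](mean_sin_affine (pi / 2) lawZ m0); congr mean; apply/funext => w.
by rewrite sinD cos_pihalf sin_pihalf mulr0 add0r mulr1.
Qed.

Variables (I : finType) (Z : I -> {RV P >-> R}).
Hypothesis lawZ : forall i, law_on_unit_interval (Z i).
Hypothesis indepZ : forall A : I -> set R, (forall i, measurable (A i)) ->
  mean P (fun w => \prod_i \1_(A i) (Z i w)) =
  \prod_i mean P (fun w => \1_(A i) (Z i w)).

Definition phase (M : I -> int) (r : seq I) w := \sum_(i <- r) 2 * pi * (M i)%:~R * Z i w.

Lemma bounded_measurable_phase M r :
  bounded_measurable (fun w => cos (phase M r w)) /\
  bounded_measurable (fun w => sin (phase M r w)).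
Proof.
have mp : measurable_fun setT (phase M r).
  apply: measurable_sum => i; apply: measurable_funM => //; exact: measurable_cst.
by split; [exact: bounded_measurable_cos|exact: bounded_measurable_sin].
Qed.

Lemma bounded_measurable_indic_comp (A : set R) i : measurable A ->
  bounded_measurable (fun w => \1_A (Z i w) : R).
Proof.
move=> mA; apply: (bounded_measurable_indic (A := Z i @^-1` A)).
by rewrite -[X in measurable X]setTI; exact: (measurable_funPT (Z i)).
Qed.

(* Turn the indicators of the product formula into characters, one variable at a time. *)
Lemma mean_phase_indic (M : I -> int) (r : seq I) (A : I -> set R) :
  uniq r -> (forall i, measurable (A i)) ->
  let rest := \prod_(i | i \notin r) mean P (fun w => \1_(A i) (Z i w)) in
  mean P (fun w => cos (phase M r w) * \prod_(i | i \notin r) \1_(A i) (Z i w)) =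
    (all (fun i => M i == 0) r)%:R * rest /\
  mean P (fun w => sin (phase M r w) * \prod_(i | i \notin r) \1_(A i) (Z i w)) = 0.
Proof.
elim: r A => [|i r IH] A /=.
  move=> _ mA; rewrite /phase; split.
    by under eq_fun do rewrite big_nil cos0 mul1r; rewrite indepZ ?mul1r.
  by under eq_fun do rewrite big_nil sin0 mul0r; rewrite mean_cst.
move=> /andP [ir ur] mA.
pose rest w := \prod_(j | j \notin i :: r) \1_(A j) (Z j w) : R.
pose C := \prod_(j | j \notin i :: r) mean P (fun w => \1_(A j) (Z j w)).
have [bcos bsin] := bounded_measurable_phase M r.
have brest : bounded_measurable rest.
  by apply: bounded_measurable_prod => j; exact: bounded_measurable_indic_comp.
have pick (G F : I -> R) (x : R) : G i = x -> (forall j, j != i -> G j = F j) ->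
    \prod_(j | j \notin r) G j = x * \prod_(j | j \notin i :: r) F j.
  move=> Gi Gj; rewrite (bigD1 i) //= Gi; congr (_ * _); apply: eq_big => j.
    by rewrite inE negb_or andbC.
  by move=> /andP [_ /Gj].
(* The induction hypothesis holds for every family of sets. Putting an arbitrary [B] at place [i]
   gives the premise of [mean_replace_indic] for the variable [Z i]. *)
have key B : measurable B ->
    mean P (fun w => \1_B (Z i w) * (cos (phase M r w) * rest w)) =
      (all (fun i => M i == 0) r)%:R * C * mean P (fun w => \1_B (Z i w)) /\
    mean P (fun w => \1_B (Z i w) * (sin (phase M r w) * rest w)) = 0.
  move=> mB; pose A' j := if j == i then B else A j.
  have mA' j : measurable (A' j) by rewrite /A'; case: ifP.
  have A'i : A' i = B by rewrite /A' eqxx.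
  have A'j j : j != i -> A' j = A j by rewrite /A' => /negbTE ->.
  have prodA' w : \prod_(j | j \notin r) \1_(A' j) (Z j w) = \1_B (Z i w) * rest w.
    by apply: pick => [|j ji]; rewrite ?A'i ?A'j.
  have [Hc Hs] := IH A' ur mA'; split.
    transitivity (mean P (fun w => cos (phase M r w) *
        \prod_(j | j \notin r) \1_(A' j) (Z j w))).
      by congr mean; apply/funext => w; rewrite prodA' mulrCA.
    rewrite Hc -mulrA; congr (_ * _); rewrite mulrC.
    by apply: pick => [|j ji]; rewrite ?A'i ?A'j.
  rewrite -Hs; congr mean; apply/funext => w.
  by rewrite prodA' mulrCA.
have bcr := bounded_measurableM bcos brest.
have bsr := bounded_measurableM bsin brest.
have keys B : measurable B ->
    mean P (fun w => \1_B (Z i w) * (sin (phase M r w) * rest w)) =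
    0 * mean P (fun w => \1_B (Z i w)).
  by move=> /key [_ ->]; rewrite mul0r.
have [mc ms] := measurable_character (M i).
have [Ec Es] := mean_character (M i) (lawZ i).
have bdc : exists N, forall x : R, `|cos (2 * pi * (M i)%:~R * x)| <= N.
  by exists 1 => x; rewrite ler_norml cos_geN1 cos_le1.
have bds : exists N, forall x : R, `|sin (2 * pi * (M i)%:~R * x)| <= N.
  by exists 1 => x; rewrite ler_norml sin_geN1 sin_le1.
have mZ : measurable_fun setT (Z i) by [].
(* These are the four products in the addition formulas for cosine and sine; only the one with two
   cosines can have a nonzero mean. *)
have := mean_replace_indic mZ bcr (fun B mB => (key B mB).1) mc bdc.
have := mean_replace_indic mZ bsr keys mc bdc.
have := mean_replace_indic mZ bcr (fun B mB => (key B mB).1) ms bds.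
have := mean_replace_indic mZ bsr keys ms bds.
rewrite Ec Es !mul0r !mulr0 => ss sc cs cc.
have mMZ : measurable_fun setT (fun w => 2 * pi * (M i)%:~R * Z i w).
  by apply: measurable_funM => //; exact: measurable_cst.
have bci := bounded_measurable_cos mMZ; have bsi := bounded_measurable_sin mMZ.
have phaseS w : phase M (i :: r) w = 2 * pi * (M i)%:~R * Z i w + phase M r w.
  by rewrite /phase big_cons.
have meanE (f g : T -> R) : f =1 g -> mean P f = mean P g by move=> /funext ->.
split.
  rewrite (meanE _ (fun w => cos (2 * pi * (M i)%:~R * Z i w) * (cos (phase M r w) * rest w) -
      sin (2 * pi * (M i)%:~R * Z i w) * (sin (phase M r w) * rest w))).
    rewrite meanB ?cc ?ss ?subr0.
    - by rewrite mulrAC -natrM mulnb andbC.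
    - exact: bounded_measurableM.
    - exact: bounded_measurableM.
  by move=> w; rewrite phaseS cosD /rest; ring.
rewrite (meanE _ (fun w => sin (2 * pi * (M i)%:~R * Z i w) * (cos (phase M r w) * rest w) +
    cos (2 * pi * (M i)%:~R * Z i w) * (sin (phase M r w) * rest w))).
  by rewrite meanD ?cs ?sc ?addr0 //; exact: bounded_measurableM.
by move=> w; rewrite phaseS sinD /rest; ring.
Qed.
End mean_of_characters.

(** * Scalar coordinates of the sample points *)

Section coordinates.
Context {dT : measure_display} {T : measurableType dT} {R : realType}.
Variables (P : probability T R) (d n : nat) (x : 'I_n -> {RV P >-> d.-tuple R}).
Hypotheses (hindep : mutually_independent x) (hunif : forall t, uniform_on_cube (x t)).

Lemma measurable_coord (t : 'I_n) (j : 'I_d) :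
  measurable_fun setT (fun w => tnth (x t w) j).
Proof. exact: (measurableT_comp (@measurable_tnth _ _ _ j)). Qed.

(** Indexing by pairs turns independence between points and within a point into one product
    formula. *)
Definition coord (i : 'I_n * 'I_d) : {RV P >-> R} :=
  HB.pack (fun w => tnth (x i.1 w) i.2)
    (isMeasurableFun.Build _ _ _ _ _ (measurable_coord i.1 i.2)).

Lemma coord_law i : law_on_unit_interval (coord i).
Proof.
case: i => t j A mA; pose A' k := if k == j then A else setT.
have mA' k : measurable (A' k) by rewrite /A'; case: ifP.
have := hunif t mA'; rewrite (bigD1 j) //= big1 => [|k kj]; last first.
  by rewrite /A' (negbTE kj) probability_setT.
rewrite mule1 {2}/A' eqxx => <-; congr (P _).
apply/seteqP; split=> w /= Aw; last by have := Aw j; rewrite /A' eqxx.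
by move=> k; rewrite /A'; case: eqP => // ->.
Qed.

(** Independence of the points splits the joint event over [t]; the law of each point on rectangles
    then splits it over [j]. *)
Lemma coord_indep (A : 'I_n * 'I_d -> set R) : (forall i, measurable (A i)) ->
  mean P (fun w => \prod_i \1_(A i) (coord i w)) =
  \prod_i mean P (fun w => \1_(A i) (coord i w)).
Proof.
move=> mA; pose B t : set (d.-tuple R) := [set v | forall j, A (t, j) (tnth v j)].
have mB t : measurable (B t).
  have -> : B t = \bigcap_(j in [set: 'I_d]) ((fun v => tnth v j) @^-1` A (t, j)).
    by apply/seteqP; split=> v /= H j => [_|]; exact: H.
  apply: fin_bigcap_measurable => // j _; rewrite -[X in measurable X]setTI.
  by apply: measurable_tnth => //; exact: mA.
have mZA i : measurable (coord i @^-1` A i).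
  by rewrite -[X in measurable X]setTI; apply: (measurable_funPT (coord i)) => //; exact: mA.
pose E : set T := \bigcap_(t in [set` [set: 'I_n]%SET]) (x t @^-1` B t).
have mE : measurable E.
  apply: fin_bigcap_measurable => // t _.
  by rewrite -[X in measurable X]setTI; exact: (measurable_funPT (x t)).
have prodE w : \prod_i \1_(A i) (coord i w) = \1_E w :> R.
  have [Ew|nEw] := pselect (E w).
    rewrite [RHS]indicE mem_set // big1 // => -[t j] _.
    have tT : [set` [set: 'I_n]%SET] t by rewrite /= inE.
    by rewrite indicE mem_set //; exact: (Ew t tT j).
  rewrite [RHS]indicE memNset //.
  have /existsNP [i nAi] : ~ forall i, A i (coord i w).
    by move=> H; apply: nEw => t _ j; exact: (H (t, j)).
  by rewrite (bigD1 i) //= indicE memNset // mul0r.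
under eq_fun do rewrite prodE.
rewrite mean_indic // (hindep (fun t _ => mB t)).
transitivity (fine (\big[*%E/1%E]_i P (coord i @^-1` A i))).
  congr fine; transitivity (\big[*%E/1%E]_t \big[*%E/1%E]_j P (coord (t, j) @^-1` A (t, j)));
    last by rewrite pair_bigA /=; apply: eq_bigr => -[].
  apply: eq_big => [t|t _]; first by rewrite inE.
  have := hunif t (fun j => mA (t, j)); rewrite /distribution /pushforward => ->.
  by apply: eq_bigr => j _; rewrite coord_law.
have finP i : P (coord i @^-1` A i) = (fine (P (coord i @^-1` A i)))%:E.
  by rewrite fineK // fin_num_measure.
rewrite (eq_bigr _ (fun i _ => finP i)).
rewrite -(big_morph EFin (@EFinM R) (erefl _)) /=.
by apply: eq_bigr => i _; symmetry; exact: (mean_indic P (mZA i)).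
Qed.

Lemma mean_cos_coord (M : 'I_n -> 'I_d -> int) :
  mean P (fun w => cos (2 * pi * \sum_t \sum_j (M t j)%:~R * tnth (x t w) j)) =
  [forall t, forall j, M t j == 0]%:R.
Proof.
pose M' i := M i.1 i.2.
(* The list contains every index, so no indicator is left and only the phase remains. *)
have [+ _] := mean_phase_indic coord_law coord_indep M'
  (enum_uniq {: 'I_n * 'I_d}) (A := fun=> setT) (fun=> measurableT).
have noti (i : 'I_n * 'I_d) : (i \notin enum {: 'I_n * 'I_d}) = false.
  by apply/negbTE; rewrite negbK mem_enum.
rewrite big_pred0 // mulr1.
rewrite (_ : all _ _ = [forall t, forall j, M t j == 0]); last first.
  apply/allP/forallP => [H t|H [t j] _]; last exact: (forallP (H t)).
  by apply/forallP => j; apply: (H (t, j)); rewrite mem_enum.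
move=> <-; congr mean; apply/funext => w.
rewrite big_pred0 // mulr1; congr cos.
rewrite /phase pair_bigA /= mulr_sumr big_enum /=.
by apply: eq_bigr => i _; rewrite mulrA.
Qed.

End coordinates.

(** * Spectra of hermitian matrices *)

Section diagonalized_matrices.
Context {R : realType} (D : nat).
Implicit Types (V A : 'M[R[i]]_D) (d : 'I_D -> R).
Local Open Scope complex_scope.

(** The rows of [V] are left eigenvectors. Spectra, traces of powers and affine functions of the
    matrix are all read off the real numbers [d]. *)
Definition diag_conj V d : 'M[R[i]]_D :=
  invmx V *m diag_mx (\row_i (d i)%:C) *m V.

Lemma hermitian_diag_conj A : A^t*%sesqui = A ->
  exists2 V, V \in unitmx & exists d, A = diag_conj V d.
Proof.
move=> Aherm; have hA : A \is hermsymmx.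
  by apply/is_hermitianmxP; rewrite expr0 scale1r.
exists (spectralmx A); first exact: spectral_unit.
exists (fun i => complex.Re (spectral_diag A 0 i)).
have /hermitian_normalmx /orthomx_spectralP {1}-> := hA.
congr (_ *m diag_mx _ *m _); apply/rowP => i; rewrite mxE RRe_real //.
exact: (mxOverP (hermitian_spectral_diag_real hA)).
Qed.

Lemma diag_conj_affine V d (a b : R) : V \in unitmx ->
  a%:C *: diag_conj V d + b%:C%:M = diag_conj V (fun i => a * d i + b).
Proof.
move=> uV; rewrite /diag_conj.
have -> : \row_i (a * d i + b)%:C = a%:C *: (\row_i (d i)%:C) + const_mx b%:C.
  by apply/rowP => i; rewrite !mxE rmorphD rmorphM.
rewrite linearD linearZ /= diag_const_mx mulmxDr mulmxDl -scalemxAr -scalemxAl.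
by congr (_ + _); rewrite scalar_mxC -mulmxA mulVmx // mulmx1.
Qed.

Lemma diag_conjM V d e : V \in unitmx ->
  diag_conj V d *m diag_conj V e = diag_conj V (fun i => d i * e i).
Proof.
move=> uV; rewrite /diag_conj.
rewrite !mulmxA.
rewrite (mulmxK uV).
congr (_ *m _).
rewrite -!mulmxA; congr (_ *m _); apply/matrixP => i j.
rewrite mulmx_diag !mxE; case: eqP => [->|_]; last by rewrite mulr0n.
by rewrite !mulr1n rmorphM.
Qed.

Lemma diag_conjX V d k : V \in unitmx ->
  diag_conj V d ^+ k = diag_conj V (fun i => d i ^+ k).
Proof.
move=> uV; elim: k => [|k IH]; last first.
  have mulE (A B : 'M[R[i]]_D) : A * B = A *m B by [].
  rewrite exprS IH.
  rewrite mulE.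
  rewrite (diag_conjM d (fun i => d i ^+ k) uV).
  congr diag_conj.
  by apply/funext => i; rewrite exprS.
rewrite expr0; have := diag_conj_affine d 0 1 uV.
rewrite scale0r add0r => diag1; transitivity ((1 : R)%:C%:M : 'M[R[i]]_D).
  by [].
rewrite diag1; congr diag_conj; apply/funext => i.
by rewrite mul0r add0r.
Qed.

Lemma mxtrace_diag_conj V d : V \in unitmx ->
  \tr (diag_conj V d) = (\sum_i d i)%:C.
Proof.
move=> uV; rewrite /diag_conj mxtrace_mulC mulmxA (mulmxV uV) mul1mx mxtrace_diag.
by rewrite rmorph_sum; apply: eq_bigr => i _; rewrite mxE.
Qed.

Lemma mxtrace_diag_conjX V d k : V \in unitmx ->
  complex.Re (\tr (diag_conj V d ^+ k)) = \sum_i d i ^+ k.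
Proof. by move=> uV; rewrite diag_conjX // mxtrace_diag_conj. Qed.

(** The rows of [V] realize every [d i]. Conversely, a left eigenvector written in the basis of
    these rows has a nonzero coordinate, and that coordinate identifies its eigenvalue. *)
Lemma real_spectrum_diag_conj V d : V \in unitmx ->
  real_spectrum (diag_conj V d) = range d.
Proof.
move=> uV; apply/seteqP; split=> [r /= /eigenvalueP [v vA v0]|_ [i _ <-] /=].
  pose u := v *m invmx V.
  have u0 : u != 0.
    by apply: contra_neq v0 => u0; rewrite -[v](mulmxKV uV) -/u u0 mul0mx.
  have ud : u *m diag_mx (\row_i (d i)%:C) = r%:C *: u.
    by rewrite /u scalemxAl -vA /diag_conj !mulmxA (mulmxK uV).
  clearbody u; have /rV0Pn [i ui] := u0; exists i => //.
  have /rowP /(_ i) := ud; rewrite mul_mx_diag !mxE mulrC => /mulIf.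
  by move=> /(_ ui) [].
apply/eigenvalueP; exists (row i V); last first.
  apply/eqP => Vi; have /rowP /(_ i) : delta_mx 0 i = 0 :> 'rV[R[i]]_D.
    by rewrite -[LHS](mulmxK uV) -rowE Vi mul0mx.
  by rewrite !mxE !eqxx => /eqP; rewrite oner_eq0.
rewrite rowE /diag_conj !mulmxA (mulmxK uV) scalemxAl.
congr (_ *m _).
apply/rowP => j; rewrite mul_mx_diag !mxE /= mulrC.
by case: eqP => [->|_] //; rewrite !mulr0.
Qed.

Lemma lambda_max_diag_conj V d : (0 < D)%N -> V \in unitmx ->
  exists2 i, lambda_max (diag_conj V d) = d i & forall j, d j <= d i.
Proof.
move=> D0 uV; pose i0 := Ordinal D0.
case: (@arg_maxP _ _ _ i0 xpredT d isT) => i _ di.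
exists i => [|j]; last exact: di.
rewrite /lambda_max real_spectrum_diag_conj //; apply/le_anti/andP; split.
  by apply: ge_sup => [|_ [j _ <-]]; [exists (d i), i|exact: di].
by apply: ub_le_sup; [exists (d i) => _ [j _ <-]; exact: di|exists i].
Qed.

Lemma lambda_min_diag_conj V d : (0 < D)%N -> V \in unitmx ->
  exists2 i, lambda_min (diag_conj V d) = d i & forall j, d i <= d j.
Proof.
move=> D0 uV; pose i0 := Ordinal D0.
case: (@arg_minP _ _ _ i0 xpredT d isT) => i _ di.
exists i => [|j]; last exact: di.
rewrite /lambda_min real_spectrum_diag_conj //; apply/le_anti/andP; split.
  by apply: ge_inf; [exists (d i) => _ [j _ <-]; exact: di|exists i].
by apply: lb_le_inf => [|_ [j _ <-]]; [exists (d i), i|exact: di].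
Qed.

Lemma lambda_max_lt V d c : (0 < D)%N -> V \in unitmx ->
  (lambda_max (diag_conj V d) < c <-> forall i, d i < c).
Proof.
move=> D0 uV; have [i -> di] := lambda_max_diag_conj d D0 uV.
by split=> // lt_c j; apply: le_lt_trans lt_c.
Qed.

Lemma lambda_min_gt V d c : (0 < D)%N -> V \in unitmx ->
  (c < lambda_min (diag_conj V d) <-> forall i, c < d i).
Proof.
move=> D0 uV; have [i -> di] := lambda_min_diag_conj d D0 uV.
by split=> // lt_c j; apply: lt_le_trans (di j).
Qed.

End diagonalized_matrices.

(** The powers of [y / Y] tend to 0. An odd exponent is sought because [measurable_lambda_max]
    compares powers with a threshold that may be negative. *)
Lemma exists_odd_pow_lt (R : realType) (D : nat) (y Y : R) : 0 < y -> y < Y ->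
  exists m : nat, D%:R * y ^+ (2 * m).+1 < Y ^+ (2 * m).+1.
Proof.
move=> y0 yY; have Y0 := lt_trans y0 yY.
have z1 : `|y / Y| < 1.
  by rewrite ger0_norm ?divr_ge0 ?(ltW y0) ?(ltW Y0) // ltr_pdivrMr // mul1r.
(* The successor makes the inverse positive even for [D = 0]. *)
have e0 : (0 : R) < D.+1%:R^-1 by rewrite invr_gt0.
have /cvgrPdist_lt /(_ _ e0) [N _ HN] := cvg_expr z1.
exists N; have := HN (2 * N).+1; rewrite /= sub0r normrN => /(_ _).
have NN : (N <= (2 * N).+1)%N by rewrite mul2n -addnn; apply: leqW; exact: leq_addr.
move=> /(_ NN); rewrite ger0_norm; last first.
  by rewrite exprn_ge0 // divr_ge0 ?(ltW y0) ?(ltW Y0).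
set k := (2 * N).+1; rewrite expr_div_n ltr_pdivrMr ?exprn_gt0 // => H.
have yk : 0 < y ^+ k by rewrite exprn_gt0.
apply: lt_trans (_ : D.+1%:R * y ^+ k < _).
  by rewrite ltr_pM2r // ltr_nat.
by rewrite mulrC -ltr_pdivlMr // mulrC.
Qed.

(** * Measurability of the extreme eigenvalues *)

Section measurable_spectrum.
Context {dT : measure_display} {T : measurableType dT} {R : realType}.
Local Open Scope complex_scope.

Definition cmeasurable (f : T -> R[i]) :=
  measurable_fun setT (fun w => complex.Re (f w)) /\
  measurable_fun setT (fun w => complex.Im (f w)).

Lemma cmeasurable_cst z : cmeasurable (fun=> z).
Proof. by split; exact: measurable_cst. Qed.

Lemma cmeasurableD f g : cmeasurable f -> cmeasurable g ->
  cmeasurable (fun w => f w + g w).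
Proof.
move=> [f1 f2] [g1 g2]; split.
  by under eq_fun do rewrite raddfD /=; exact: measurable_funD.
by under eq_fun do rewrite raddfD /=; exact: measurable_funD.
Qed.

Lemma cmeasurableM f g : cmeasurable f -> cmeasurable g ->
  cmeasurable (fun w => f w * g w).
Proof.
have mulE (y z : R[i]) : y * z =
    (complex.Re y * complex.Re z - complex.Im y * complex.Im z) +i*
    (complex.Re y * complex.Im z + complex.Im y * complex.Re z).
  by case: y z => a b [c e].
move=> [f1 f2] [g1 g2]; split; under eq_fun do rewrite mulE /=.
  by apply: measurable_funB; exact: measurable_funM.
by apply: measurable_funD; exact: measurable_funM.
Qed.

Lemma cmeasurable_sum (I : Type) (r : seq I) (f : I -> T -> R[i]) :
  (forall i, cmeasurable (f i)) -> cmeasurable (fun w => \sum_(i <- r) f i w).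
Proof.
move=> mf; elim: r => [|i r IH].
  by under eq_fun do rewrite big_nil; exact: cmeasurable_cst.
by under eq_fun do rewrite big_cons; exact: cmeasurableD.
Qed.

Definition mx_measurable m p (A : T -> 'M[R[i]]_(m, p)) :=
  forall i j, cmeasurable (fun w => A w i j).

Lemma mx_measurable_mul m p q (A : T -> 'M[R[i]]_(m, p)) (B : T -> 'M[R[i]]_(p, q)) :
  mx_measurable A -> mx_measurable B -> mx_measurable (fun w => A w *m B w).
Proof.
move=> mA mB i j; under eq_fun do rewrite mxE.
by apply: cmeasurable_sum => k; exact: cmeasurableM.
Qed.

Lemma mx_measurable_exp m (A : T -> 'M[R[i]]_m) k :
  mx_measurable A -> mx_measurable (fun w => A w ^+ k).
Proof.
move=> mA; elim: k => [|k IH].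
  by move=> i j; under eq_fun do rewrite expr0; exact: cmeasurable_cst.
have -> : (fun w => A w ^+ k.+1) = (fun w => A w *m A w ^+ k).
  by apply/funext => w; rewrite exprS.
exact: mx_measurable_mul.
Qed.

Lemma measurable_trace_exp m (A : T -> 'M[R[i]]_m) k :
  mx_measurable A -> measurable_fun setT (fun w => complex.Re (\tr (A w ^+ k))).
Proof.
move=> mA; apply: (proj1 (cmeasurable_sum (f := fun i w => (A w ^+ k) i i) _ _)).
by move=> i; exact: mx_measurable_exp.
Qed.

Lemma measurable_set_lt (f g : T -> R) : measurable_fun setT f ->
  measurable_fun setT g -> measurable [set w | f w < g w].
Proof.
move=> mf mg; rewrite -[X in measurable X]setTI.
exact: (measurable_fun_ltr mf mg measurableT (Y := [set true])).
Qed.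

Variables (D : nat) (A : T -> 'M[R[i]]_D).
Hypotheses (D0 : (0 < D)%N) (hA : forall w, (A w)^t*%sesqui = A w) (mA : mx_measurable A).

(* For [B >= 0] and an odd exponent, [lambda_max B < s] as soon as [tr B^k < s^k],
   and conversely for large [k]; the shift by [1 + tr A^2] makes [A] positive. *)
Lemma measurable_lambda_max : measurable_fun setT (fun w => lambda_max (A w)).
Proof.
pose q w := 1 + complex.Re (\tr (A w ^+ 2)).
have mq : measurable_fun setT q.
  by apply: measurable_funD; [exact: measurable_cst|exact: measurable_trace_exp].
pose B w := A w + (q w)%:C%:M.
have mB : mx_measurable B.
  move=> i j; under eq_fun do rewrite !mxE; apply: cmeasurableD => //.
  case: (i == j); under eq_fun do rewrite ?mulr1n ?mulr0n; last exact: cmeasurable_cst.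
  by split => //=; exact: measurable_cst.
apply: (measurability _ (RGenInftyO.measurableE R)) => _ [_ [s ->] <-].
rewrite setTI.
have -> : (fun w => lambda_max (A w)) @^-1` `]-oo, s[ =
    \bigcup_m [set w | complex.Re (\tr (B w ^+ (2 * m).+1)) < (s + q w) ^+ (2 * m).+1].
  apply/funext => w; apply/propext; rewrite /= in_itv /=.
  have [V uV [d Ad]] := hermitian_diag_conj (hA w).
  have qE : q w = 1 + \sum_i d i ^+ 2 by rewrite /q Ad mxtrace_diag_conjX.
  have BE : B w = diag_conj V (fun i => d i + q w).
    rewrite /B Ad -[X in X + _]scale1r (diag_conj_affine d 1 (q w) uV).
    by congr diag_conj; apply/funext => i; rewrite mul1r.
  (* This holds because 1 + x + x^2 > 0 for every real x. *)
  have dq i : 0 < d i + q w.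
    rewrite qE (bigD1 i) //=.
    have : 0 <= \sum_(j | j != i) d j ^+ 2 by apply: sumr_ge0 => j _; rewrite sqr_ge0.
    nra.
  have trE k : complex.Re (\tr (B w ^+ k)) = \sum_i (d i + q w) ^+ k.
    by rewrite BE mxtrace_diag_conjX.
  rewrite Ad; split=> [|[m _ /=]]; last first.
    rewrite trE => lt_tr; apply/(lambda_max_lt d s D0 uV) => i.
    rewrite -(ltrD2r (q w)) ltNge; apply/negP => sdi.
    (* Here oddness matters: a negative threshold keeps its sign under the power. *)
    have odd_le : (s + q w) ^+ (2 * m).+1 <= (d i + q w) ^+ (2 * m).+1.
      have [sq0|sq0] := leP 0 (s + q w); first by rewrite lerXn2r // nnegrE ltW.
      apply: (@le_trans _ _ 0); last by rewrite exprn_ge0 // ltW.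
      by rewrite exprS nmulr_rle0 // mulnC exprM sqr_ge0.
    have := lt_le_trans lt_tr odd_le; apply/negP; rewrite -leNgt.
    rewrite (bigD1 i) //= lerDl; apply: sumr_ge0 => j _.
    by rewrite exprn_ge0 // ltW.
  have [i -> di] := lambda_max_diag_conj d D0 uV => dis.
  have dis' : d i + q w < s + q w by rewrite ltrD2r.
  have [m Hm] := exists_odd_pow_lt D (dq i) dis'.
  exists m => //=; rewrite trE; apply: le_lt_trans Hm.
  (* The trace is at most [D] times the power of the largest eigenvalue. *)
  rewrite mulr_natl -[X in _ *+ X]card_ord -sumr_const; apply: ler_sum => j _.
  by rewrite lerXn2r ?nnegrE ?(ltW (dq _)) // lerD2r.
apply: bigcup_measurable => m _; apply: measurable_set_lt.
  exact: measurable_trace_exp.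
by apply: measurable_funX; apply: measurable_funD => //; exact: measurable_cst.
Qed.

End measurable_spectrum.

Section spectral_events.
Context {R : realType}.
Local Open Scope complex_scope.

Lemma lambda_minN (D : nat) (A : 'M[R[i]]_D) : (0 < D)%N ->
  A^t*%sesqui = A -> lambda_min A = - lambda_max (- A).
Proof.
move=> D0 /hermitian_diag_conj [V uV [d ->]].
have -> : - diag_conj V d = diag_conj V (fun i => - d i).
  have z0 : (0 : R)%:C%:M = 0 :> 'M[R[i]]_D by apply/matrixP => i j; rewrite !mxE mul0rn.
  have := diag_conj_affine d (-1) 0 uV; rewrite rmorphN1 scaleN1r z0 addr0 => ->.
  by congr diag_conj; apply/funext => i; rewrite mulN1r addr0.
have [i -> di] := lambda_min_diag_conj d D0 uV.
have [j -> dj] := lambda_max_diag_conj (fun i => - d i) D0 uV.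
rewrite opprK; apply/le_anti; rewrite di /= -lerN2; exact: dj.
Qed.

Lemma measurable_lambda_min (dT : measure_display) (T : measurableType dT) (D : nat)
    (A : T -> 'M[R[i]]_D) : (0 < D)%N -> (forall w, (A w)^t*%sesqui = A w) ->
  mx_measurable A -> measurable_fun setT (fun w => lambda_min (A w)).
Proof.
move=> D0 hA mA; under eq_fun do rewrite lambda_minN //.
apply: (@measurable_funN _ _ _ _ (fun w => lambda_max (- A w))).
apply: measurable_lambda_max => // [w|i j].
  by rewrite linearN /= map_mxN hA.
have -> : (fun w => (- A w) i j) = (fun w => (-1) * A w i j).
  by apply/funext => w; rewrite mxE mulN1r.
by apply: cmeasurableM => //; exact: cmeasurable_cst.
Qed.

(** For a hermitian A the product A^*A is A^2, with eigenvalues [d i ^+ 2], so the norm is the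
    largest [|d i|]. As [V] is only invertible, hermitianness is a separate hypothesis. *)
Lemma opnorm_lt (D : nat) (V : 'M[R[i]]_D) (d : 'I_D -> R) (e : R) : (0 < D)%N ->
  V \in unitmx -> (diag_conj V d)^t*%sesqui = diag_conj V d ->
  (opnorm (diag_conj V d) < e <-> forall i, `|d i| < e).
Proof.
move=> D0 uV hA; rewrite /opnorm hA (diag_conjM d d uV).
have [i -> di] := lambda_max_diag_conj (fun i => d i * d i) D0 uV.
rewrite -expr2 sqrtr_sqr; split=> // lt_e j; apply: le_lt_trans lt_e.
by rewrite -ler_sqr ?nnegrE // !real_normK ?num_real // !expr2.
Qed.

(** For [g w != 0] cross-multiply according to its sign. For [g w = 0] the quotient is +oo, 0 or -oo
    according to the sign of [f w], hence at most [c] exactly when [f w <= 0]. *)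
Lemma measurable_cond_le (dT : measure_display) (T : measurableType dT) (f g : T -> R)
    (c : R) : 0 <= c -> measurable_fun setT f -> measurable_fun setT g ->
  measurable [set w | ((f w)%:E / (g w)%:E <= c%:E)%E].
Proof.
move=> c0 mf mg.
have m0 : measurable_fun setT (fun _ : T => 0 : R) by exact: measurable_cst.
have mcg : measurable_fun setT (fun w => c * g w).
  by apply: measurable_funM => //; exact: measurable_cst.
have -> : [set w | ((f w)%:E / (g w)%:E <= c%:E)%E] =
    ([set w | 0 < g w] `&` ~` [set w | c * g w < f w]) `|`
    ([set w | g w < 0] `&` ~` [set w | f w < c * g w]) `|`
    (~` [set w | 0 < g w] `&` ~` [set w | g w < 0] `&` ~` [set w | 0 < f w]).
  apply/funext => w; apply/propext => /=.
  have [g0|g0|<-] := ltgtP 0 (g w).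
  - rewrite inver (gt_eqF g0) -EFinM lee_fin ler_pdivrMr //.
    split=> [fc|[[[_ /negP]|[]]|[[]]]//]; last by rewrite -leNgt.
    by left; left; split=> //; apply/negP; rewrite -leNgt.
  - rewrite inver (lt_eqF g0) -EFinM lee_fin ler_ndivrMr //.
    split=> [fc|[[[]|[_ /negP]]|[[]]]//]; last by rewrite -leNgt.
    by left; right; split=> //; apply/negP; rewrite -leNgt.
  - rewrite inver eqxx; have [f0|f0|<-] := ltgtP 0 (f w).
    + rewrite gt0_muley ?lte_fin // leye_eq; split=> // -[[[]|[]]|[_ []]] //.
    + rewrite lt0_muley ?lte_fin // leNye; split=> // _; right; split=> //.
    + rewrite mul0e lee_fin c0; split=> // _; right; split=> //.
apply: measurableU; first apply: measurableU.
- by apply: measurableI; [|apply: measurableC]; exact: measurable_set_lt.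
- by apply: measurableI; [|apply: measurableC]; exact: measurable_set_lt.
- by apply: measurableI; [apply: measurableI|]; apply: measurableC; exact: measurable_set_lt.
Qed.

End spectral_events.

(** * Traces of powers and closed walks *)

Section closed_walks.
Variables (I : finType) (V : zmodType) (gamma : I -> V) (n p : nat).
Hypothesis gamma_inj : injective gamma.
Variable t : {ffun 'I_p -> 'I_n}.

Local Notation src l := (widen_ord (leqnSn p) l).
Local Notation tgt l := (lift ord0 l).

Definition walk_steps (f : {ffun 'I_p.+1 -> I}) := [forall l : 'I_p, f (src l) != f (tgt l)].

(** Summed over all letters the increments telescope, so for injective [gamma] balance already makes
    the walk close up; the counts below are therefore stated for balanced walks. *)
Definition balanced (f : {ffun 'I_p.+1 -> I}) :=
  [forall s, \sum_(l | t l == s) (gamma (f (tgt l)) - gamma (f (src l))) == 0].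

(** At a letter occurring once, balance makes its only increment vanish, which would be a stationary
    step. *)
Lemma balanced_singleton f : balanced f -> walk_steps f -> no_singleton t.
Proof.
move=> /forallP bf /forallP sf; apply/forallP => l; apply: contraT => /existsPn nl.
have := bf (t l); rewrite (bigD1 l) //= big1 => [|k /andP [tk kl]]; last first.
  by have := nl k; rewrite kl tk.
rewrite addr0 subr_eq0 => /eqP /gamma_inj /esym fl.
by have := sf l; rewrite fl eqxx.
Qed.

Definition first_visits : {set 'I_p} :=
  [set l : 'I_p | [forall k : 'I_p, (k < l)%N ==> (t k != t l)]]%SET.

Lemma card_word_letters_first : (#|word_letters t| <= #|first_visits|)%N.
Proof.
apply: leq_trans (leq_imset_card t first_visits).
apply/subset_leq_card/fintype.subsetP => s /imsetP [l _ ->].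
case: (@arg_minnP _ l (fun k => t k == t l) val (eqxx _)) => k /eqP tk kmin.
apply/imsetP; exists k => //; rewrite inE; apply/forallP => j; apply/implyP => jk.
by apply/eqP => tj; have := kmin j; rewrite tj tk eqxx leqNgt jk => /(_ isT).
Qed.

(** What is removed are the starting vertices of first visits; the last vertex of the walk is never
    among them. *)
Definition free_positions : {set 'I_p.+1} := (~: [set src l | l in first_visits])%SET.

(* At the first visit of a letter, the balance at this letter determines the
   current vertex by later ones: read the walk backwards. *)
Lemma balanced_determined f g : balanced f -> balanced g ->
  {in free_positions, f =1 g} -> f = g.
Proof.
move=> /forallP bf /forallP bg fg; apply/ffunP => l.
have [k] := ubnP (p - l); elim: k l => // k IH l lk.
have [/fg //|] := boolP (l \in free_positions).
rewrite inE negbK => /imsetP [l' + lE]; rewrite inE => /forallP first_l.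
have later (i : 'I_p) : t i == t l' -> i != l' -> (l' < i)%N.
  move=> ti il; rewrite ltn_neqAle eq_sym val_eqE il leqNgt /=.
  by apply/negP => il'; have := first_l i; rewrite il' ti.
have IHl (j : 'I_p.+1) : (l' < j)%N -> f j = g j.
  move=> lj; apply: IH; apply: (@leq_trans (p - l)); last by rewrite -ltnS.
  by rewrite lE /= ltn_sub2l.
have Ef := eqP (bf (t l')); have Eg := eqP (bg (t l')).
rewrite (bigD1 l') //= in Ef; rewrite (bigD1 l') //= in Eg.
(* The other steps with this letter come later, so both their ends lie beyond [l'] and agree by
   induction. Only the start of step [l'] is still undetermined. *)
have rest : \sum_(i | (t i == t l') && (i != l')) (gamma (f (tgt i)) - gamma (f (src i))) =
    \sum_(i | (t i == t l') && (i != l')) (gamma (g (tgt i)) - gamma (g (src i))).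
  apply: eq_bigr => i /andP [ti il]; have li := later i ti il.
  by rewrite !IHl //= /bump /= add1n ltnS ltnW.
rewrite rest in Ef; move: (etrans Ef (esym Eg)) => /addIr.
rewrite IHl ?lE; last by rewrite /= /bump /= add1n.
by move=> /addrI /oppr_inj /gamma_inj.
Qed.

Lemma card_balanced :
  (#|[set f | balanced f]%SET| <= #|I| ^ (p.+1 - #|word_letters t|))%N.
Proof.
have [I0|I0] := posnP #|I|.
  rewrite eq_card0 // => f; have := fintype0 (f ord0).
  by move=> /(_ I0).
pose restr (f : {ffun 'I_p.+1 -> I}) : {ffun {l | l \in free_positions} -> I} :=
  [ffun q => f (val q)].
have restr_inj : {in [set f | balanced f]%SET &, injective restr}.
  move=> f g; rewrite !inE => bf bg /ffunP fg; apply: balanced_determined => // l lQ.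
  by have := fg (Sub l lQ); rewrite !ffunE SubK.
apply: leq_trans (leq_card_in restr _ restr_inj) _.
have cQ : (#|free_positions| <= p.+1 - #|word_letters t|)%N.
  rewrite cardsCs /free_positions finset.setCK card_ord leq_sub2l //.
  have src_inj : injective (fun l : 'I_p => src l).
    by move=> a b /(congr1 val) /= ab; apply: val_inj.
  by rewrite [leqRHS](card_imset _ src_inj) card_word_letters_first.
by rewrite card_ffun card_sig leq_pexp2l.
Qed.

(** Words with a singleton have weight 0 and admit no such walk; for the others this is
    [card_balanced] with the power of [#|I|] split into two factors. *)
Lemma card_balanced_steps (K : realFieldType) : (0 < #|I|)%N ->
  #|[set f | balanced f && walk_steps f]%SET|%:R <=
  #|I|%:R ^+ p.+1 * word_weight (#|I|%:R^-1 : K) t.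
Proof.
move=> I0; rewrite /word_weight; have [nt|st] := boolP (no_singleton t); last first.
  rewrite mulr0 eq_card0 // => f; rewrite !inE; apply/negP => /andP [bf sf].
  by rewrite (balanced_singleton bf sf) in st.
(* This makes the subtraction in the exponent a true one, so that the power can be split. *)
have bp : (#|word_letters t| <= p.+1)%N.
  by apply: leq_trans (card_word_letters_first) _;
    rewrite ltnW // ltnS -[leqRHS]card_ord max_card.
apply: le_trans (_ : (#|I| ^ (p.+1 - #|word_letters t|))%:R <= _).
  rewrite ler_nat; apply: leq_trans card_balanced; apply/subset_leq_card/fintype.subsetP => f.
  by rewrite !inE => /andP [].
by rewrite natrX exprVn exprB // ?unitfE ?pnatr_eq0 -?lt0n.
Qed.

End closed_walks.

Section trace_of_powers.
Variables (K : comNzRingType) (D : nat) (A : 'M[K]_D).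

(** The endpoints are fixed by indicator factors, so that the index set is the same for all [i], [j]
    and the trace can be summed under the sum over walks. *)
Lemma exp_mx_walks p i j :
  (A ^+ p) i j = \sum_(f : {ffun 'I_p.+1 -> 'I_D})
    (f ord0 == i)%:R * (f ord_max == j)%:R *
    \prod_(l < p) A (f (widen_ord (leqnSn p) l)) (f (lift ord0 l)).
Proof.
elim: p i j => [|p IH] i j.
  pose F (s : 'I_D) (g : {ffun 'I_0 -> 'I_D}) : K := (s == i)%:R * (s == j)%:R.
  transitivity (\sum_(f : {ffun 'I_1 -> 'I_D}) F (f ord0) [ffun l => f (lift ord0 l)]).
    rewrite sum_ffun_lift /F expr0 mxE (bigD1 i) //= [X in _ + X]big1 => [|s si]; last first.
      by rewrite big1 // => g _; rewrite (negbTE si) mul0r.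
    by rewrite addr0 sumr_const card_ffun !card_ord expn0 eqxx mul1r.
  apply: eq_bigr => f _; rewrite /F big_ord0 mulr1.
  by rewrite (_ : ord_max = ord0) //; apply: val_inj.
pose F (s : 'I_D) (g : {ffun 'I_p.+1 -> 'I_D}) : K :=
  (s == i)%:R * (g ord_max == j)%:R * (A s (g ord0) *
    \prod_(l < p) A (g (widen_ord (leqnSn p) l)) (g (lift ord0 l))).
transitivity (\sum_(f : {ffun 'I_p.+2 -> 'I_D}) F (f ord0) [ffun l => f (lift ord0 l)]).
  have mulE (B C : 'M[K]_D) : B * C = B *m C by [].
  rewrite sum_ffun_lift /F (bigD1 i) //= [X in _ + X]big1 => [|s si]; last first.
    by rewrite big1 // => g _; rewrite (negbTE si) !mul0r.
  rewrite addr0 exprS mulE mxE.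
  transitivity (\sum_m \sum_(g : {ffun 'I_p.+1 -> 'I_D}) A i m *
      ((g ord0 == m)%:R * (g ord_max == j)%:R *
      \prod_(l < p) A (g (widen_ord (leqnSn p) l)) (g (lift ord0 l)))).
    by apply: eq_bigr => m _; rewrite -mulr_sumr; congr (_ * _); exact: IH.
  rewrite exchange_big /=; apply: eq_bigr => g _.
  rewrite eqxx mul1r (bigD1 (g ord0)) //= [X in _ + X]big1 => [|s sg]; last first.
    by rewrite eq_sym (negbTE sg) !mul0r mulr0.
  by rewrite addr0 eqxx mul1r mulrCA.
apply: eq_bigr => f _; rewrite /F big_ord_recl !ffunE.
congr (_ * (f _ == j)%:R * (A (f _) _ * _)); [exact: val_inj|exact: val_inj|].
by apply: eq_bigr => l _; rewrite !ffunE; congr (A (f _) _); apply: val_inj.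
Qed.

Lemma mxtrace_exp_walks p :
  \tr (A ^+ p) = \sum_(f : {ffun 'I_p.+1 -> 'I_D}) (f ord0 == f ord_max)%:R *
    \prod_(l < p) A (f (widen_ord (leqnSn p) l)) (f (lift ord0 l)).
Proof.
rewrite /mxtrace; under eq_bigr do rewrite exp_mx_walks.
rewrite exchange_big /=; apply: eq_bigr => f _.
rewrite (bigD1 (f ord0)) //= [X in _ + X]big1 => [|s sf].
  by rewrite addr0 eqxx mul1r eq_sym.
by rewrite eq_sym (negbTE sf) !mul0r.
Qed.

End trace_of_powers.

(** * Characters and the walk expansion of the Gram matrix *)

Section characters.
Context {R : realType}.
Local Open Scope complex_scope.

Definition cis (r : R) : R[i] := cos (2 * pi * r) +i* sin (2 * pi * r).

Lemma cisD r s : cis (r + s) = cis r * cis s.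
Proof.
rewrite /cis mulrDr cosD sinD; apply/eqP; rewrite eq_complex /=.
by rewrite eqxx addrC eqxx.
Qed.

Lemma cis0 : cis 0 = 1.
Proof. by rewrite /cis mulr0 cos0 sin0. Qed.

Lemma cis_sum (I : Type) (r : seq I) (Q : pred I) (F : I -> R) :
  \prod_(i <- r | Q i) cis (F i) = cis (\sum_(i <- r | Q i) F i).
Proof. by rewrite (big_morph cis cisD cis0). Qed.

Lemma conjC_cis r : Num.conj (cis r) = cis (- r).
Proof. by rewrite /cis mulrN cosN sinN. Qed.

Lemma cexp_cis r : cexp (2 * pi%:C * 'i * r%:C) = cis r :> R[i].
Proof.
have -> : 2 * pi%:C * 'i * r%:C = 0 +i* (2 * pi * r) :> R[i].
  rewrite (_ : 2 = (2 : R)%:C :> R[i]) ?rmorph_nat //.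
  by apply/eqP; rewrite eq_complex /=; apply/andP; split; apply/eqP; ring.
by rewrite /cexp /= expR0 mul1r.
Qed.

Lemma dotZR_sum d (I : Type) (r : seq I) (Q : pred I) (F : I -> 'rV[int]_d)
    (x : d.-tuple R) :
  dotZR (\sum_(i <- r | Q i) F i) x = \sum_(i <- r | Q i) dotZR (F i) x.
Proof.
rewrite /dotZR exchange_big /=; apply: eq_bigr => j _.
by rewrite summxE rmorph_sum mulr_suml.
Qed.

Lemma dotZRB d (k l : 'rV[int]_d) (x : d.-tuple R) :
  dotZR (k - l) x = dotZR k x - dotZR l x.
Proof.
rewrite /dotZR -sumrB; apply: eq_bigr => j _.
by rewrite !mxE rmorphB mulrBl.
Qed.

End characters.

Section fourier_gram.
Context {R : realType}.
Variables (d n D : nat) (Gamma : {fset 'rV[int]_d}) (x : 'I_n -> d.-tuple R).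
Local Open Scope complex_scope.

Definition frequency (k : 'I_D) : 'rV[int]_d := (enum_fset Gamma)`_k.

Definition gram : 'M[R[i]]_D :=
  (fourier_mx D Gamma x)^t*%sesqui *m fourier_mx D Gamma x.

Definition deviation : 'M[R[i]]_D := n%:R^-1 *: gram - 1%:M.

Lemma fourier_mxE t k : fourier_mx D Gamma x t k = cis (dotZR (frequency k) (x t)).
Proof. by rewrite mxE cexp_cis. Qed.

Lemma gramE k l : gram k l = \sum_t cis (dotZR (frequency l - frequency k) (x t)).
Proof.
rewrite mxE; apply: eq_bigr => t _.
by rewrite fourier_mxE !mxE cexp_cis conjC_cis -cisD dotZRB addrC.
Qed.

Lemma gram_hermitian : gram^t*%sesqui = gram.
Proof. by rewrite /gram trmx_mul map_mxM trmxCK. Qed.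

(** The entries of U have modulus 1, so the diagonal of [n^-1 gram] is 1 and cancels. This is why
    stationary steps do not contribute. *)
Lemma deviationE k l : (0 < n)%N -> deviation k l = ((n%:R : R)^-1)%:C *
  ((k != l)%:R * \sum_t cis (dotZR (frequency l - frequency k) (x t))).
Proof.
move=> n0; have nC : (n%:R : R[i]) = (n%:R)%:C by rewrite rmorph_nat.
have nC0 : (n%:R)%:C != 0 :> R[i] by rewrite -nC pnatr_eq0 -lt0n.
rewrite /deviation 2!mxE gramE !mxE nC -fmorphV; have [->|kl] := eqVneq k l.
  rewrite mul0r mulr0 (eq_bigr (fun=> 1)) => [|t _].
    by rewrite sumr_const card_ord nC fmorphV mulVf ?subrr.
  by rewrite subrr /dotZR big1 ?cis0 // => j _; rewrite mxE mul0r.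
by rewrite mul1r subr0.
Qed.

Section walk_expansion.
Variable p : nat.
Local Notation src l := (widen_ord (leqnSn p) l).
Local Notation tgt l := (lift ord0 l).

Definition closed_walk (f : {ffun 'I_p.+1 -> 'I_D}) :=
  (f ord0 == f ord_max) && walk_steps f.

(** The total frequency with which the sample point [x s] enters the term of [f] and [t]; balance
    means that it vanishes for every [s]. *)
Definition frequency_at (f : {ffun 'I_p.+1 -> 'I_D}) (t : {ffun 'I_p -> 'I_n}) s :=
  \sum_(l | t l == s) (frequency (f (tgt l)) - frequency (f (src l))).

(** Expanding each entry over the sample points attaches a letter to each step, and grouping the
    steps by letter collects the character of each point. The real part leaves cosines, whose means
    are given by [mean_cos_coord]. *)
Lemma trace_deviation : (0 < n)%N -> complex.Re (\tr (deviation ^+ p)) =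
  (n%:R ^- p) * \sum_(f | closed_walk f) \sum_(t : {ffun 'I_p -> 'I_n})
    cos (2 * pi * \sum_s dotZR (frequency_at f t s) (x s)).
Proof.
move=> n0; rewrite mxtrace_exp_walks.
have ReM (a : R) (z : R[i]) : complex.Re (a%:C * z) = a * complex.Re z.
  by case: z => u v /=; rewrite mul0r subr0.
have walkE (f : {ffun 'I_p.+1 -> 'I_D}) : (f ord0 == f ord_max)%:R *
    \prod_(l < p) deviation (f (src l)) (f (tgt l)) =
    (n%:R ^- p)%:C * ((closed_walk f)%:R * \sum_(t : {ffun 'I_p -> 'I_n})
      cis (\sum_s dotZR (frequency_at f t s) (x s))) :> R[i].
  rewrite (eq_bigr _ (fun l _ => deviationE _ _ n0)) big_split /= prodr_const card_ord.
  rewrite mulrCA -exprVn rmorphXn /=; congr (_ * _).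
  rewrite big_split /= mulrA; congr (_ * _).
    rewrite /closed_walk -mulnb natrM; congr (_ * _).
    have [sf|/forallPn [l fl]] := boolP (walk_steps f).
      by rewrite big1 // => l _; rewrite (forallP sf).
    by rewrite (bigD1 l) //= (negbTE fl) mul0r.
  rewrite bigA_distr_bigA /=; apply: eq_bigr => t _.
  rewrite cis_sum; congr cis; rewrite (partition_big t predT) //=.
  apply: eq_bigr => s _; rewrite dotZR_sum.
  by apply: eq_bigr => l /eqP ->.
rewrite (eq_bigr _ (fun f _ => walkE f)) -mulr_sumr ReM; congr (_ * _).
rewrite raddf_sum [RHS]big_mkcond /=; apply: eq_bigr => f _.
case: (closed_walk f); last by rewrite mul0r.
by rewrite mul1r raddf_sum.
Qed.

End walk_expansion.
End fourier_gram.

(** * Moments of the deviation and choice of the exponent *)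

Section moment_bound.
Context {dT : measure_display} {T : measurableType dT} {R : realType}.
Variables (P : probability T R) (d n D : nat) (Gamma : {fset 'rV[int]_d}).
Variable x : 'I_n -> {RV P >-> d.-tuple R}.
Hypotheses (hindep : mutually_independent x) (hunif : forall t, uniform_on_cube (x t)).
Hypotheses (hD : #|` Gamma| = D) (D0 : (0 < D)%N) (n0 : (0 < n)%N).

Let X w : 'M[R[i]]_D := deviation D Gamma (fun t => x t w).

Lemma frequency_inj : injective (@frequency d D Gamma).
Proof.
move=> k l /eqP; rewrite nth_uniq ?hD ?fset_uniq ?ltn_ord // => /eqP.
exact: val_inj.
Qed.

Lemma mean_trace_deviation (p : nat) :
  bounded_measurable (fun w => complex.Re (\tr (X w ^+ p))) /\
  mean P (fun w => complex.Re (\tr (X w ^+ p))) <=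
    n%:R ^- p * (D%:R ^+ p.+1 * total_weight 'I_n (D%:R^-1 : R) p).
Proof.
pose F (f : {ffun 'I_p.+1 -> 'I_D}) (t : {ffun 'I_p -> 'I_n}) w : R :=
  cos (2 * pi * \sum_s dotZR (frequency_at Gamma f t s) (x s w)).
have trE : (fun w => complex.Re (\tr (X w ^+ p))) = (fun w => n%:R ^- p *
    \sum_(f | closed_walk f) \sum_(t : {ffun 'I_p -> 'I_n}) F f t w).
  by apply/funext => w; rewrite /X trace_deviation.
have bF f t : bounded_measurable (F f t).
  apply: bounded_measurable_cos; apply: measurable_funM; first exact: measurable_cst.
  apply: measurable_sum => s; apply: measurable_sum => j.
  by apply: measurable_funM; [exact: measurable_cst|exact: measurable_coord].
have bFs (f : {ffun 'I_p.+1 -> 'I_D}) :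
    bounded_measurable (fun w => \sum_(t : {ffun 'I_p -> 'I_n}) F f t w).
  exact: bounded_measurable_sum.
rewrite trE; split.
  by apply: bounded_measurableM; [exact: bounded_measurable_cst|exact: bounded_measurable_sum].
rewrite meanZ; last exact: bounded_measurable_sum.
rewrite ler_wpM2l ?invr_ge0 ?exprn_ge0 //.
rewrite mean_sum //; under eq_bigr do rewrite mean_sum //.
rewrite exchange_big /= /total_weight mulr_sumr; apply: ler_sum => t _.
have meanF (f : {ffun 'I_p.+1 -> 'I_D}) :
    mean P (F f t) = (balanced (@frequency d D Gamma) t f)%:R.
  rewrite [LHS](mean_cos_coord hindep hunif (fun s j => frequency_at Gamma f t s 0 j)).
  congr (nat_of_bool _)%:R; apply/forallP/forallP => H s.
    by apply/eqP/rowP => j; rewrite (eqP (forallP (H s) j)) mxE.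
  by apply/forallP => j; have /eqP := H s; rewrite /frequency_at => ->; rewrite mxE.
under eq_bigr do rewrite meanF.
(* For a fixed word the mean counts balanced closed walks without stationary step; it is bounded by
   the count that [card_balanced_steps] estimates. *)
apply: le_trans
  (_ : #|[set f | balanced (@frequency d D Gamma) t f && walk_steps f]%SET|%:R <= _).
  rewrite -sum1_card natr_sum big_mkcond [leRHS]big_mkcond /=.
  apply: ler_sum => f _; rewrite inE /closed_walk.
  by case: (f ord0 == _) (walk_steps f) (balanced _ _ _) => [] [] [].
have := card_balanced_steps frequency_inj t R; rewrite card_ord; exact.
Qed.

End moment_bound.

Lemma moment_bound (dT : measure_display) (T : measurableType dT) (R : realType)
    (P : probability T R) (d n D : nat) (Gamma : {fset 'rV[int]_d})
    (x : 'I_n -> {RV P >-> d.-tuple R}) (alpha : R) (m : nat) :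
  mutually_independent x -> (forall t, uniform_on_cube (x t)) ->
  #|` Gamma| = D -> (0 < D)%N -> (0 < n)%N -> 0 < alpha < 1 ->
  m%:R <= alpha * n%:R / (3 * D%:R) ->
  mean P (fun w => complex.Re (\tr (deviation D Gamma (fun t => x t w) ^+ (2 * m)))) <=
    D%:R * alpha ^+ m.
Proof.
move=> hindep hunif hD D0 n0 /andP [a0 a1] hm.
have [_ moment] := mean_trace_deviation hindep hunif hD D0 n0 (2 * m).
apply: le_trans moment _.
have nR : 0 < n%:R :> R by rewrite ltr0n.
have DR : 0 < D%:R :> R by rewrite ltr0n.
pose r : R := n%:R / D%:R.
have r0 : 0 < r by rewrite divr_gt0.
have mr : 3 * m%:R <= alpha * r.
  have hm' : m%:R * (3 * D%:R) <= alpha * n%:R by rewrite -ler_pdivlMr ?mulr_gt0.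
  rewrite /r mulrA ler_pdivlMr // (_ : 3 * m%:R * D%:R = m%:R * (3 * D%:R)) //; ring.
have s0 : 0 <= Num.sqrt alpha by rewrite sqrtr_ge0.
have s1 : Num.sqrt alpha <= 1 by rewrite -[leRHS]sqrtr1 ler_wsqrtr // ltW.
have ss : Num.sqrt alpha ^+ 2 = alpha by rewrite sqr_sqrtr // ltW.
(* With c = sqrt(alpha) r and sqrt(alpha) <= 1, for p <= 2m we get (p/2) c + p r <= (3/2) p r <= 3 m
   r <= alpha r^2 = c^2. This is the origin of the 3 in the hypothesis on n. *)
have weight : total_weight 'I_n (D%:R^-1 : R) (2 * m) <= (Num.sqrt alpha * r) ^+ (2 * m).
  have z0 : 0 <= D%:R^-1 :> R by rewrite invr_ge0 ler0n.
  apply: (total_weight_le z0 (q := (2 * m)%N)) => // [|p pm].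
    by rewrite mulr_ge0 // ltW.
  rewrite card_ord (mulrC D%:R^-1) -/r exprMn ss.
  have pm' : p%:R <= 2 * m%:R :> R by rewrite -natrM ler_nat ltnW.
  apply: le_trans (_ : alpha * r * r <= _); last by rewrite expr2 mulrA.
  rewrite mulrA -mulrDl ler_pM2r //.
  apply: le_trans mr; apply: le_trans (_ : p%:R / 2 * 1 + p%:R <= _); last by lra.
  by rewrite lerD2r ler_wpM2l // divr_ge0.
apply: le_trans (_ : n%:R ^- (2 * m) *
    (D%:R ^+ (2 * m).+1 * (Num.sqrt alpha * r) ^+ (2 * m)) <= _).
  by rewrite ler_wpM2l ?invr_ge0 ?exprn_ge0 // ler_wpM2l ?exprn_ge0.
rewrite exprMn [Num.sqrt alpha ^+ _]exprM ss /r expr_div_n exprS.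
rewrite le_eqVlt; apply/orP; left; apply/eqP.
have nk : n%:R ^+ (2 * m) != 0 :> R by rewrite expf_neq0 // lt0r_neq0.
have Dk : D%:R ^+ (2 * m) != 0 :> R by rewrite expf_neq0 // lt0r_neq0.
by field; rewrite nk Dk.
Qed.

(** Here [e] stands for eps^2. Since ln(e / alpha) > 0, exponentiating the hypothesis gives D
    alpha^m <= delta (1 - alpha) e^m, and 1 - alpha <= 1. *)
Lemma failure_bound (R : realType) (D m : nat) (e alpha delta : R) : (0 < D)%N ->
  0 < alpha < e -> e < 1 -> 0 < delta ->
  (ln (e / alpha))^-1 * ln (D%:R / (delta * (1 - alpha))) <= m%:R ->
  D%:R * alpha ^+ m <= delta * e ^+ m.
Proof.
move=> D0 /andP [a0 ae] e1 d0.
have a1 : 0 < 1 - alpha by rewrite subr_gt0 (lt_trans ae).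
have DR : 0 < D%:R :> R by rewrite ltr0n.
have e0 := lt_trans a0 ae.
have q1 : 1 < e / alpha by rewrite ltr_pdivlMr // mul1r.
rewrite mulrC ler_pdivrMr ?ln_gt0 // [m%:R * _]mulr_natl -lnXn ?(lt_trans ltr01 q1) //.
rewrite ler_ln ?posrE ?divr_gt0 ?mulr_gt0 ?exprn_gt0 ?divr_gt0 //.
rewrite ler_pdivrMr ?mulr_gt0 // expr_div_n mulrAC ler_pdivlMr ?exprn_gt0 //.
move=> H; apply: le_trans H _; rewrite mulrC ler_pM2r ?exprn_gt0 //.
by rewrite ler_piMr ?(ltW d0) // gerBl ltW.
Qed.

Section gram_spectrum.
Context {R : realType}.
Local Open Scope complex_scope.

Lemma hermitian_affine (D : nat) (A : 'M[R[i]]_D) (a b : R) :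
  A^t*%sesqui = A -> (a%:C *: A + b%:C%:M)^t*%sesqui = a%:C *: A + b%:C%:M.
Proof.
move=> hA; apply/matrixP => i j; rewrite !mxE.
have /matrixP /(_ i j) := hA; rewrite !mxE => <-.
have conjR (r : R) : Num.conj (r%:C) = r%:C.
  by apply/CrealP; exact/complex_realP/(ex_intro _ r).
rewrite rmorphD rmorphM /= conjR eq_sym.
by case: (i == j); rewrite ?mulr1n ?mulr0n ?conjR ?rmorph0.
Qed.

Lemma mx_measurable_affine (dT : measure_display) (T : measurableType dT) (D : nat)
    (A : T -> 'M[R[i]]_D) (a b : R) :
  mx_measurable A -> mx_measurable (fun w => a%:C *: A w + b%:C%:M).
Proof.
move=> mA i j; under eq_fun do rewrite !mxE.
apply: cmeasurableD; last exact: cmeasurable_cst.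
by apply: cmeasurableM => //; exact: cmeasurable_cst.
Qed.

Lemma mx_measurable_gram (dT : measure_display) (T : measurableType dT)
    (P : probability T R) (d n D : nat) (Gamma : {fset 'rV[int]_d})
    (x : 'I_n -> {RV P >-> d.-tuple R}) :
  mx_measurable (fun w => gram D Gamma (fun t => x t w)).
Proof.
move=> k l; under eq_fun do rewrite gramE.
apply: cmeasurable_sum => t.
have mx : measurable_fun setT (fun w =>
    2 * pi * dotZR (frequency Gamma l - frequency Gamma k) (x t w)).
  apply: measurable_funM; first exact: measurable_cst.
  apply: measurable_sum => j.
  by apply: measurable_funM; [exact: measurable_cst|exact: measurable_coord].
split; apply: (measurableT_comp (continuous_measurable_fun _) mx).
  exact: continuous_cos.
exact: continuous_sin.
Qed.

End gram_spectrum.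

(** * The three events and Markov's inequality *)

Theorem theorem4p1 (R : realType) (dT : measure_display) (T : measurableType dT)
    (P : probability T R)
    (d : nat) (hd : (1 <= d)%N)
    (Gamma : {fset 'rV[int]_d}) (hGamma : Gamma != fset0)
    (D : nat) (hD : #|` Gamma| = D)
    (n : nat) (x : 'I_n -> {RV P >-> d.-tuple R})
    (hindep : mutually_independent x)
    (hunif : forall t, uniform_on_cube (x t))
    (eps alpha delta : R)
    (heps : 0 < eps < 1) (halpha : 0 < alpha < eps ^+ 2) (hdelta : 0 < delta)
    (hn : (ln (eps ^+ 2 / alpha))^-1 * ln (D%:R / (delta * (1 - alpha)))
          <= (Num.floor (alpha * n%:R / (3 * D%:R)))%:~R) :
  let U (w : T) : 'M[R[i]]_(n, D) := fourier_mx D Gamma (fun t => x t w) in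
  let G (w : T) : 'M[R[i]]_D := (U w)^t*%sesqui *m U w in
  let H (w : T) : 'M[R[i]]_D := n%:R^-1 *: G w in
  let close : set T := [set w | opnorm (H w - 1%:M) < eps] in
  let spectral : set T :=
    [set w | [/\ 1 - eps < lambda_min (H w),
                 lambda_min (H w) <= lambda_max (H w) &
                 lambda_max (H w) < 1 + eps]] in
  let well_conditioned : set T :=
    [set w | (cond_number (G w) <= ((1 + eps) / (1 - eps))%:E)%E] in
  [/\ holds_with_prob_ge P (1 - delta) close,
      close `<=` spectral,
      holds_with_prob_ge P (1 - delta) spectral &
      holds_with_prob_ge P (1 - delta) well_conditioned].
Proof.
move=> U G H close spectral well_conditioned.
have D0 : (0 < D)%N by rewrite -hD cardfs_gt0.
have [e0 e1] := andP heps.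
have [a0 ae] := andP halpha.
have e2 : eps ^+ 2 < 1 by rewrite expr_lt1 // ltW.
pose nv : R := n%:R^-1.
have GE w : G w = gram D Gamma (fun t => x t w) by [].
have nvE : (n%:R : R[i])^-1 = (real_complex R nv) by rewrite /nv fmorphV rmorph_nat.
have hG w : (G w)^t*%sesqui = G w by exact: gram_hermitian.
have HE w : H w = real_complex R nv *: G w + (real_complex R 0)%:M.
  have z0 : (real_complex R 0)%:M = 0 :> 'M[R[i]]_D.
    by apply/matrixP => i j; rewrite !mxE mul0rn.
  by rewrite /H nvE z0 addr0.
have XE w : H w - 1%:M = real_complex R nv *: G w + (real_complex R (-1))%:M.
  by rewrite /H nvE rmorphN1 raddfN.
have hH w : (H w)^t*%sesqui = H w by rewrite HE hermitian_affine.
have mG : mx_measurable G by exact: (mx_measurable_gram Gamma x).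
have mH : mx_measurable H.
  by rewrite (_ : H = fun w => real_complex R nv *: G w + (real_complex R 0)%:M);
    [exact: mx_measurable_affine|exact/funext].
(* One basis diagonalizes all three matrices, so every event becomes a condition on the same
   numbers. *)
have spec w : exists2 V, V \in unitmx & exists d, [/\ G w = diag_conj V d,
    H w = diag_conj V (fun i => nv * d i) & H w - 1%:M = diag_conj V (fun i => nv * d i - 1)].
  have [V uV [d' GV]] := hermitian_diag_conj (hG w).
  exists V => //; exists d'; split=> //.
    by rewrite HE GV (diag_conj_affine d' nv 0 uV); congr diag_conj;
      apply/funext => i; rewrite addr0.
  by rewrite XE GV (diag_conj_affine d' nv (-1) uV).
have closeP w V d' : V \in unitmx -> H w - 1%:M = diag_conj V (fun i => nv * d' i - 1) ->
    close w <-> forall i, `|nv * d' i - 1| < eps.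
  move=> uV XV; have hX : (H w - 1%:M)^t*%sesqui = H w - 1%:M.
    by rewrite XE hermitian_affine.
  by rewrite /close /= XV; apply: opnorm_lt => //; rewrite -XV.
(* Equality, beyond the inclusion claimed, lets [close] inherit its measurability from the extreme
   eigenvalues. *)
have close_spectral : close = spectral.
  apply/funext => w; apply/propext.
  have [V uV [d' [GV HV XV]]] := spec w.
  rewrite (closeP w V d' uV XV) /spectral /= HV.
  have lmin := lambda_min_gt (fun i => nv * d' i) (1 - eps) D0 uV.
  have lmax := lambda_max_lt (fun i => nv * d' i) (1 + eps) D0 uV.
  split=> [near1|[/lmin lo _ /lmax hi] i].
    split; [apply/lmin|idtac|apply/lmax].
    - by move=> i; have := near1 i; rewrite ltr_norml => /andP [? ?]; lra.
    - have [i -> di] := lambda_min_diag_conj (fun i => nv * d' i) D0 uV.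
      by have [j -> _] := lambda_max_diag_conj (fun i => nv * d' i) D0 uV; exact: di.
    - by move=> i; have := near1 i; rewrite ltr_norml => /andP [? ?]; lra.
  by rewrite ltr_norml; have := lo i; have := hi i => ? ?; apply/andP; split; lra.
have mspectral : measurable spectral.
  have -> : spectral =
      [set w | 1 - eps < lambda_min (H w)] `&` [set w | lambda_max (H w) < 1 + eps].
    apply/seteqP; split=> w /=; first by case.
    move=> [lo hi]; split=> //; have [V uV [d' [_ HV _]]] := spec w.
    rewrite HV; have [i -> di] := lambda_min_diag_conj (fun i => nv * d' i) D0 uV.
    by have [j -> _] := lambda_max_diag_conj (fun i => nv * d' i) D0 uV; exact: di.
  apply: measurableI; apply: measurable_set_lt; try exact: measurable_cst.
    exact: measurable_lambda_min.
  exact: measurable_lambda_max.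
have mclose : measurable close by rewrite close_spectral.
have mwell : measurable well_conditioned.
  apply: measurable_cond_le; last 2 first.
  - exact: measurable_lambda_max.
  - exact: measurable_lambda_min.
  by rewrite divr_ge0 //; lra.
have spectral_well : spectral `<=` well_conditioned.
  move=> w; have [V uV [d' [GV HV XV]]] := spec w.
  move=> [/= lo _ hi].
  have {}lo := (lambda_min_gt _ _ D0 uV).1
    (eq_ind _ (fun A => 1 - eps < lambda_min A) lo _ HV).
  have {}hi := (lambda_max_lt _ _ D0 uV).1
    (eq_ind _ (fun A => lambda_max A < 1 + eps) hi _ HV).
  rewrite /well_conditioned /= /cond_number GV.
  have [i -> _] := lambda_max_diag_conj d' D0 uV.
  have [j -> _] := lambda_min_diag_conj d' D0 uV.
  have [loj hii] := (lo j, hi i); rewrite /= in loj hii.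
  have ndj : 0 < nv * d' j by lra.
  (* A positive eigenvalue of [H w] excludes [n = 0], where [nv] is 0 by convention. *)
  have nv0 : 0 < nv.
    by rewrite lt0r invr_ge0 ler0n andbT; apply: contraTneq ndj => ->; rewrite mul0r ltxx.
  have dj : 0 < d' j by move: ndj; rewrite pmulr_rgt0.
  have e1' : 0 < 1 - eps by lra.
  rewrite inver (gt_eqF dj) -EFinM lee_fin ler_pdivrMr //.
  (* The condition number is unchanged by scaling, so eigenvalues of [H w] are compared instead of
     those of [G w]. *)
  rewrite -(ler_pM2l nv0) mulrCA; apply: le_trans (ltW hii) _.
  by rewrite mulrAC ler_pdivlMr // ler_wpM2l ?ltW //; lra.
have close_prob : ((1 - delta)%:E <= P close)%E.
  pose y : R := alpha * n%:R / (3 * D%:R).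
  have y0 : 0 <= y by rewrite divr_ge0 ?mulr_ge0 // ltW.
  pose m := `|Num.floor y|%N.
  have mE : (Num.floor y)%:~R = m%:R :> R.
    by rewrite -[in LHS](gez0_abs (_ : 0 <= Num.floor y)) ?floor_ge0 // -pmulrn.
  have my : m%:R <= y by rewrite -mE floor_le.
  have bound : D%:R * alpha ^+ m <= delta * (eps ^+ 2) ^+ m.
    by apply: failure_bound => //; rewrite -mE.
  have -> : P close = (fine (P close))%:E by rewrite fineK // fin_num_measure.
  (* For [n = 0] also [m = 0], and [bound] reads D <= delta; hence delta >= 1 and the claim is
     trivial. *)
  rewrite lee_fin; have [n0|n0] := posnP n.
    have m0 : m = 0%N.
      by apply/eqP; move: my; rewrite /y n0 mulr0 mul0r lern0.
    move: bound; rewrite m0 !expr0 !mulr1 => Ddelta.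
    have D1 : (1 : R) <= D%:R by rewrite ler1n.
    apply: (@le_trans _ _ 0); first by lra.
    exact: fine_ge0.
  have a1 : alpha < 1 by apply: lt_trans e2.
  have moment := moment_bound hindep hunif hD D0 n0 (introT andP (conj a0 a1)) my.
  have mcloseC : measurable (~` close) by exact: measurableC.
  have [btr _] := mean_trace_deviation hindep hunif hD D0 n0 (2 * m).
  have bC := bounded_measurable_indic mcloseC.
  have meanC : fine (P close) = 1 - mean P (fun w => \1_(~` close) w).
    rewrite -(mean_indic P mclose) -[X in X - _](mean_cst P 1) -meanB //; last first.
      exact: bounded_measurable_cst.
    congr mean; apply/funext => w; rewrite !indicE in_setC.
    by case: (w \in close); rewrite ?subr0 ?subrr.
  rewrite meanC lerD2l lerN2.
  have em : 0 < (eps ^+ 2) ^+ m by rewrite !exprn_gt0.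
  (* Markov's inequality, pointwise: the trace is a sum of even powers of the eigenvalues of
     [H w - 1%:M], all nonnegative, and outside [close] one of them is at least eps^(2m). *)
  rewrite -(ler_pM2r em); apply: le_trans bound; apply: le_trans moment.
  rewrite mulrC -meanZ //; apply: mean_le => // [|w].
    by apply: bounded_measurableM => //; exact: bounded_measurable_cst.
  have -> : deviation D Gamma (fun t => x t w) = H w - 1%:M by [].
  have [V uV [d' [GV HV XV]]] := spec w.
  rewrite XV mxtrace_diag_conjX //.
  have pos i : 0 <= (nv * d' i - 1) ^+ (2 * m) by rewrite exprM exprn_ge0 // sqr_ge0.
  rewrite indicE in_setC; have [wc|/negP wc] := boolP (w \in close).
    by rewrite mulr0 sumr_ge0.
  have /existsNP [i /negP] : ~ forall i, `|nv * d' i - 1| < eps.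
    by move=> near1; apply: wc; rewrite inE; exact: (closeP w V d' uV XV).2.
  rewrite -leNgt mulr1 => far; rewrite (bigD1 i) //=.
  apply: ler_wpDr; first exact: sumr_ge0.
  rewrite exprM; apply: lerXn2r; rewrite ?nnegrE ?sqr_ge0 //.
  by rewrite -[leRHS]real_normK ?num_real // lerXn2r // nnegrE ltW.
by split; rewrite -?close_spectral //; split=> //; rewrite ?close_spectral //;
  apply: le_trans close_prob _; rewrite close_spectral; apply: le_measure; rewrite ?inE.
Qed.
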